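(* Let $q$ be a prime power and let $m$ be an even positive integer. Then $\mathcal{C}_{(q,m)}$ is a cyclic code over $\mathbb{F}_q$ with parameters $[q^{2m}-1,\; m^2,\; (q^{2m}-q^{2m-1})(1-q^{-2})]$, and its weight distribution is given by the following list of (Hamming weight, frequency) pairs, where $f_j$ is as defined in the context: \begin{itemize} \item weight $0$, frequency $1$; \item for each $1\le j\le m$: weight $q^{2m}-q^{2m-1}-(-1)^jq^{2m-j-1}(q-1)$, frequency $f_j$. \end{itemize}
   Context: An $[n,k,d]$ code over $\mathbb{F}_q$ is a $k$-dimensional subspace of $\mathbb{F}_q^n$ with minimum Hamming distance $d$. Vectors $(c_0,\dots,c_{n-1})\in\mathbb{F}_q^n$ are identified with $c_0+c_1x+\cdots+c_{n-1}x^{n-1}\in\mathbb{F}_q[x]/(x^n-1)$; a cyclic code is an ideal $\langle g(x)\rangle$ with $g$ monic dividing $x^n-1$, and $(x^n-1)/g(x)$ is its parity-check polynomial. The weight distribution records the number $A_w$ of codewords of each Hamming weight $w$; $A_w$ is the sum of the frequencies of all listed entries whose weight equals $w$ (and $0$ if there are none). Definition of $\mathcal{C}_{(q,m)}$ for even $m$: let $s=2m$, $n=q^s-1$, $t=m/2$, let $\pi$ be a generator of $\mathbb{F}_{q^s}^*$, and for an integer $u$ let $h_u(x)$ be the minimal polynomial of $\pi^{-u}$ over $\mathbb{F}_q$. Let $h'(x)=\prod_{i=1}^{t}h_{q^{2i-1}+1}(x)$. Then $\mathcal{C}_{(q,m)}$ is the cyclic code of length $n$ over $\mathbb{F}_q$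 with parity-check polynomial $h'(x)$. The numbers $f_j$: $f_0=1$ and, for $1\le j\le m$, $$f_j=\left(\prod_{i=0}^{j-1}\frac{(-q)^m-(-q)^i}{(-q)^j-(-q)^i}\right)\prod_{\ell=0}^{j-1}\left((-1)^{m+1}q^m+(-1)^{\ell+1}q^{\ell}\right).$$ *)

(* Defs.v *)
From HB Require Import structures.
From mathcomp Require Import all_boot all_order all_algebra all_field.
From mathcomp Require Import qpoly.

Set Implicit Arguments.
Unset Strict Implicit.
Unset Printing Implicit Defensive.

Import GRing.Theory.
Local Open Scope ring_scope.

Section Codes.
Variable F : finFieldType.

Definition hdist n (u v : 'rV[F]_n) : nat := #|[set i | u 0 i != v 0 i]|.

Definition hweight n (c : 'rV[F]_n) : nat := #|[set i | c 0 i != 0]|.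

Definition min_distance n (V : {vspace 'rV[F]_n}) (d : nat) : Prop :=
  (exists u v, [/\ u \in V, v \in V, u != v & hdist u v = d]) /\
  (forall u v, u \in V -> v \in V -> u != v -> (d <= hdist u v)%N).

Definition is_code n (C : {set 'rV[F]_n}) (k d : nat) : Prop :=
  exists V : {vspace 'rV[F]_n}, [/\ C =i V, \dim V = k & min_distance V d].

Definition qclass n (p : {poly F}) : {poly %/ ('X^n - 1 : {poly F})} :=
  in_qpoly ('X^n - 1) p.

(* A vector c is identified with the class of rVpoly c = \sum_i c 0 i *: 'X^i
   in F[X]/(X^n - 1), so this is the ideal generated by the class of g.
   For n = 0 the polynomial 'X^n - 1 vanishes and the definition is
   meaningless. *)
Definition cyclic_code n (g : {poly F}) : {set 'rV[F]_n} :=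
  [set c | [exists a, qclass n (rVpoly c) == a * qclass n g]].

Definition cyclic_with_parity_check n (C : {set 'rV[F]_n}) (h : {poly F}) :
    Prop :=
  exists g : {poly F}, [/\ g \is monic, g %| 'X^n - 1,
    C = cyclic_code n g & h = ('X^n - 1) %/ g].

Definition weight_count n (C : {set 'rV[F]_n}) (w : nat) : nat :=
  #|[set c in C | hweight c == w]|.

(* Each entry of T is a pair (weight, frequency); entries of equal weight are
   added up. *)
Definition has_weight_distribution n (C : {set 'rV[F]_n})
    (T : seq (rat * rat)) : Prop :=
  forall w : nat,
    (weight_count C w)%:R = \sum_(e <- T | e.1 == w%:R) e.2.

End Codes.

Section Construction.
Variables (F : finFieldType) (L : fieldExtType F).

Fact minPolyF_subproof (x : L) :
  exists p : {poly F}, map_poly (in_alg L) p == minPoly 1 x.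
Proof.
by have /polyOver1P[p Dp] := minPolyOver 1 x; exists p; rewrite Dp eqxx.
Qed.

(* minPoly 1 x has type {poly L}; this is the same polynomial seen in F[X]. *)
Definition minPolyF (x : L) : {poly F} := xchoose (minPolyF_subproof x).

Lemma map_minPolyF (x : L) : map_poly (in_alg L) (minPolyF x) = minPoly 1 x.
Proof. exact/eqP/(xchooseP (minPolyF_subproof x)). Qed.

Definition is_mul_generator (x : L) : Prop :=
  x != 0 /\ forall y : L, y != 0 -> exists k : int, y = x ^ k.

Definition h_ (x : L) (u : int) : {poly F} := minPolyF (x ^ (- u)).

Definition h'_ (x : L) (q m : nat) : {poly F} :=
  \prod_(1 <= i < (m./2).+1) h_ x (q ^ (2 * i - 1) + 1)%N.

Definition C_ (x : L) (q m : nat) : {set 'rV[F]_(q ^ (2 * m) - 1)} :=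
  cyclic_code (q ^ (2 * m) - 1) (('X^(q ^ (2 * m) - 1) - 1) %/ h'_ x q m).

End Construction.

Definition freq (q m j : nat) : rat :=
  (\prod_(0 <= i < j)
     (((- q%:R) ^+ m - (- q%:R) ^+ i) / ((- q%:R) ^+ j - (- q%:R) ^+ i))) *
  \prod_(0 <= l < j) ((-1) ^+ (m + 1) * q%:R ^+ m + (-1) ^+ (l + 1) * q%:R ^+ l).

Definition weight (q m j : nat) : rat :=
  q%:R ^+ (2 * m) - q%:R ^+ (2 * m - 1)
  - (-1) ^+ j * q%:R ^+ (2 * m - j - 1) * (q%:R - 1).

(* Main.v *)
Require Import Defs.
From HB Require Import structures.
From mathcomp Require Import all_boot all_order all_algebra all_field.
From mathcomp Require Import mxabelem qpoly.
From mathcomp Require Import ring lra zify.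

Set Implicit Arguments.
Unset Strict Implicit.
Unset Printing Implicit Defensive.

Import Order.TTheory GRing.Theory Num.Theory.
Local Open Scope ring_scope.

(** Let K be the subfield of L with q^2 elements and y |-> v(y) the bijection
    L -> K^m given by the relative traces Tr(x^i y), i < m.  A Hermitian matrix
    A over K yields the word c_A = (v(x^j) A v(x^j)^* )_j over F, whose j-th
    entry is a polynomial in x^j with exponents q^(2k) + q^(2l+1); hence c_A is
    annihilated by gcd(h', X^n - 1).  The map A |-> c_A is injective on q^(m^2)
    matrices while deg h' <= m^2, so h' divides X^n - 1 and the code consists
    exactly of the words c_A.

    The weight of c_A depends only on the rank r of A: counting pairs (u, v)
    with equal values of the form shows that the numbers of vectors of value 0
    and of value 1 differ by q^(2m-r) up to sign, and the sign is (-1)^r because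
    this difference is 1 modulo q + 1.  The number of Hermitian
    matrices of each rank obeys a recursion in m obtained by bordering a matrix
    with one row and column. *)

(** * Frobenius maps and root counts in finite fields *)

Lemma pnat_pchar_card (K : finFieldType) : [pchar K].-nat #|K|.
Proof.
have [p pr_p pK] := finPcharP K.
rewrite (eq_pnat _ (pcharf_eq pK)) (card_pprimeChar pK : #|K| = _).
by rewrite pnatX pnat_id.
Qed.

Lemma exists_frobenius (R : comNzRingType) (q : nat) : [pchar R].-nat q ->
  exists s : {rmorphism R -> R}, forall z, s z = z ^+ q.
Proof.
move=> pq; pose f (z : R) := z ^+ q.
have fa : nmod_morphism f.
  split=> [|x y]; last exact: exprDn_pchar.
  by case/andP: pq => q0 _; rewrite /f expr0n eqn0Ngt q0.
have fm : monoid_morphism f.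
  by split=> [|x y]; [exact: expr1n | exact: exprMn].
pose g : {rmorphism R -> R} := HB.pack f
  (GRing.isNmodMorphism.Build R R f fa) (GRing.isMonoidMorphism.Build R R f fm).
by exists g.
Qed.

(** ['X^#|K| - 'X] is a product of distinct linear factors over [K], so each divisor is, up to a
    unit, a subproduct. Root counts thus reduce to divisibility. *)
Lemma card_root_genPoly (K : finFieldType) (p : {poly K}) :
  p %| 'X^#|K| - 'X -> #|[set z | root p z]| = (size p).-1.
Proof.
rewrite finField_genPoly => /dvdp_prod_XsubC[s eqp_ps].
rewrite (eqp_size eqp_ps) size_prod_XsubC /=.
have us: uniq (mask s (index_enum K)) by rewrite mask_uniq // index_enum_uniq.
rewrite -(card_uniqP us); apply: eq_card => z.
by rewrite inE (eqp_root eqp_ps) root_prod_XsubC.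
Qed.

(** * The field with q^2 elements: conjugation, trace and norm *)

Section QuadraticExtension.
Variables (K : finFieldType) (q : nat) (cardK : #|K| = (q ^ 2)%N).

Lemma q_gt1 : (1 < q)%N.
Proof. by have := finNzRing_gt1 K; rewrite cardK; case: (q) => [|[]]. Qed.

Lemma q_gt0 : (0 < q)%N. Proof. exact: ltnW q_gt1. Qed.

Lemma pnat_pchar_q : [pchar K].-nat q.
Proof. by have := pnat_pchar_card K; rewrite cardK pnatX orbF. Qed.

Lemma exprqK (z : K) : (z ^+ q) ^+ q = z.
Proof. by rewrite -exprM mulnn -cardK expf_card. Qed.

Lemma pnat_pchar_polyq : [pchar {poly K}].-nat q.
Proof.
by rewrite (eq_pnat _ (pchar_poly K)) pnat_pchar_q.
Qed.

Let XK : 'X^#|K| - 'X = ('X^q + 'X) ^+ q - ('X^q + 'X) :> {poly K}.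
Proof.
rewrite (exprDn_pchar _ _ pnat_pchar_polyq) -exprM mulnn -cardK; ring.
Qed.

(** With p = X^q - X one has X^(q^2) - X = p^q + p, which p divides. *)
Lemma card_conj_fixed : #|[set z : K | z ^+ q == z]| = q.
Proof.
have sz : size ('X^q - 'X : {poly K}) = q.+1.
  by rewrite size_polyDl ?size_polyN ?size_polyXn ?size_polyX // ltnS q_gt1.
transitivity (size ('X^q - 'X : {poly K})).-1; last by rewrite sz.
rewrite -card_root_genPoly.
  by apply: eq_card => z; rewrite !inE rootE !hornerE subr_eq0.
have -> : 'X^#|K| - 'X = ('X^q - 'X) ^+ q + ('X^q - 'X) :> {poly K}.
  rewrite (exprDn_pchar _ _ pnat_pchar_polyq) exprNn_pchar ?pnat_pchar_polyq //.
  by rewrite -exprM mulnn -cardK; ring.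
by rewrite dvdp_addr // dvdp_exp // q_gt0.
Qed.

(** With p = X^q + X - a and a^q = a, one has X^(q^2) - X = p^q - p, so p has q roots in [K]. *)
Lemma card_trace_fibre (a : K) :
  a ^+ q = a -> #|[set z : K | z + z ^+ q == a]| = q.
Proof.
move=> aq.
have sz : size ('X^q + ('X - a%:P) : {poly K}) = q.+1.
  by rewrite size_polyDl ?size_XsubC ?size_polyXn // ltnS q_gt1.
transitivity (size ('X^q + ('X - a%:P) : {poly K})).-1; last by rewrite sz.
rewrite -card_root_genPoly.
  by apply: eq_card => z; rewrite !inE rootE hornerD hornerXn hornerXsubC addrA subr_eq0 addrC.
have -> : 'X^#|K| - 'X
    = ('X^q + ('X - a%:P)) ^+ q - ('X^q + ('X - a%:P)) :> {poly K}.
  rewrite XK !(exprDn_pchar _ _ pnat_pchar_polyq).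
  rewrite exprNn_pchar ?pnat_pchar_polyq // -polyC_exp aq; ring.
by rewrite dvdp_subr // dvdp_exp // q_gt0.
Qed.

(** Since a^(q-1) = 1, the polynomial X^(q+1) - a divides X^(q^2) - X and has q + 1 roots in [K]. *)
Lemma norm_surj (a : K) : a != 0 -> a ^+ q = a -> exists u : K, u ^+ q.+1 = a.
Proof.
move=> a0 aq.
have a1 : a ^+ q.-1 = 1.
  by apply: (mulfI a0); rewrite mulr1 -exprS prednK ?q_gt0.
have sz : size ('X^(q.+1) - a%:P : {poly K}) = q.+2.
  by rewrite size_XnsubC.
have dvd : ('X^(q.+1) - a%:P) %| ('X^#|K| - 'X : {poly K}).
  have -> : 'X^#|K| - 'X = ('X^(q.+1) ^+ q.-1 - a%:P ^+ q.-1) * 'X :> {poly K}.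
    rewrite -polyC_exp a1 mulrBl mul1r -exprM -exprSr; congr ('X^_ - _).
    have := q_gt0; rewrite cardK; case: (q) => // r _; nia.
  by rewrite dvdp_mulr // subrXX dvdp_mulr.
have := card_root_genPoly dvd; rewrite sz /= => cd.
have /card_gt0P[u] : (0 < #|[set z | root ('X^(q.+1) - a%:P) z]|)%N by rewrite cd.
by rewrite inE rootE !hornerE subr_eq0 => /eqP <-; exists u.
Qed.

End QuadraticExtension.

(** * Hermitian matrices and the effect of bordering on the rank *)

Section HermitianMatrices.
Variables (K : finFieldType) (q : nat) (cardK : #|K| = (q ^ 2)%N).
Variables (s : {rmorphism K -> K}) (sE : forall z, s z = z ^+ q).

Definition adjoint m n (A : 'M[K]_(m, n)) : 'M[K]_(n, m) := map_mx s A^T.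
Local Notation "A ^h" := (adjoint A) (at level 1, format "A ^h").

Definition hermitian m (A : 'M[K]_m) := A^h == A.

Lemma conjK : involutive s.
Proof. by move=> z; rewrite !sE (exprqK cardK). Qed.

Lemma adjointK m n (A : 'M[K]_(m, n)) : A^h ^h = A.
Proof. by apply/matrixP => i j; rewrite !mxE conjK. Qed.

Lemma adjointM m n p (A : 'M[K]_(m, n)) (B : 'M_(n, p)) :
  (A *m B)^h = B^h *m A^h.
Proof. by rewrite /adjoint trmx_mul map_mxM. Qed.

Lemma adjointD m n (A B : 'M[K]_(m, n)) : (A + B)^h = A^h + B^h.
Proof. by rewrite /adjoint linearD map_mxD. Qed.

Lemma adjointB m n (A B : 'M[K]_(m, n)) : (A - B)^h = A^h - B^h.
Proof. by rewrite /adjoint linearB map_mxB. Qed.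

Lemma adjointZ m n a (A : 'M[K]_(m, n)) : (a *: A)^h = s a *: A^h.
Proof. by rewrite /adjoint linearZ map_mxZ. Qed.

Lemma adjoint_scalar m a : (a%:M : 'M_m)^h = (s a)%:M.
Proof. by rewrite /adjoint tr_scalar_mx map_scalar_mx. Qed.

Lemma adjoint_block m n p r (A : 'M[K]_(m, n)) (B : 'M_(m, p))
    (C : 'M_(r, n)) (D : 'M_(r, p)) :
  (block_mx A B C D)^h = block_mx A^h C^h B^h D^h.
Proof. by rewrite /adjoint tr_block_mx map_block_mx. Qed.

Lemma adjoint_eq0 m n (A : 'M[K]_(m, n)) : (A^h == 0) = (A == 0).
Proof. by rewrite /adjoint map_mx_eq0 trmx_eq0. Qed.

Lemma hermitianB m (A B : 'M[K]_m) :
  hermitian A -> hermitian B -> hermitian (A - B).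
Proof. by rewrite /hermitian adjointB => /eqP -> /eqP ->. Qed.

Definition bordered m (t : K * 'rV[K]_m * 'M[K]_m) : 'M_(1 + m) :=
  block_mx t.1.1%:M t.1.2 t.1.2^h t.2.

Lemma bordered_inj m : injective (@bordered m).
Proof.
move=> [[d v] A] [[d' v'] A'] /eq_block_mx[/= eqd -> _ ->].
by congr (_, _, _); have /matrixP/(_ 0 0) := eqd; rewrite !mxE.
Qed.

Lemma hermitian_bordered m (t : K * 'rV[K]_m * 'M[K]_m) :
  hermitian (bordered t) = (s t.1.1 == t.1.1) && hermitian t.2.
Proof.
rewrite /hermitian /bordered adjoint_block adjoint_scalar adjointK.
apply/eqP/andP => [/eq_block_mx[eqd _ _ ->]|[/eqP -> /eqP ->] //].
by split=> //; have /matrixP/(_ 0 0) := eqd; rewrite !mxE !mulr1n => ->.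
Qed.

Lemma hermitian_unborder m (B : 'M[K]_(1 + m)) :
  hermitian B -> B = bordered (B 0 0, ursubmx B, drsubmx B).
Proof.
move=> /eqP hB; rewrite /bordered /= -{1}[B]submxK; congr block_mx.
  rewrite [LHS]mx11_scalar; congr (_%:M); rewrite !mxE; congr (B _ _); exact: val_inj.
by apply/matrixP => i j; rewrite !mxE -{1}hB !mxE.
Qed.

(* Subtracting w times the last m rows, and the adjoint column operation,
   clears the border and leaves d - w A w^h in the corner. *)
Lemma rank_bordered_in m d (v w : 'rV[K]_m) A :
  hermitian A -> v = w *m A ->
  \rank (bordered (d, v, A)) = (\rank A + (d%:M != w *m A *m w^h))%N.
Proof.
move=> /eqP hA ->; pose e := d%:M - w *m A *m w^h.
pose P : 'M[K]_(1 + m) := block_mx 1%:M w 0 1%:M.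
have uP : P \in unitmx by rewrite unitmxE det_ublock !det1 mulr1 unitr1.
have uP' : P^h \in unitmx.
  by rewrite unitmxE /adjoint det_map_mx det_tr rmorph_unit // -unitmxE.
have -> : bordered (d, w *m A, A) = P *m block_mx e 0 0 A *m P^h.
  rewrite /bordered /P adjoint_block !mulmx_block adjoint_scalar rmorph1 /=.
  rewrite /adjoint trmx0 map_mx0 -!/(adjoint _) adjoint_scalar rmorph1.
  rewrite !mul1mx !mulmx1 !mul0mx !mulmx0 !add0r !addr0 subrK.
  by rewrite adjointM hA.
rewrite mxrankMfree ?row_free_unit // eqmxMfull ?row_full_unit //.
rewrite rank_diag_block_mx addnC; congr (_ + _)%N.
by rewrite rank_rV subr_eq0.
Qed.

(** Adjoining the column [v^h] to [A] raises the rank by one, as [v^h] lies outside the column space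
    of the Hermitian [A]; the top row raises it again, since its tail [v] lies outside the row
    space. *)
Lemma rank_bordered_notin m d (v : 'rV[K]_m) A :
  hermitian A -> ~~ (v <= A)%MS -> \rank (bordered (d, v, A)) = (\rank A).+2.
Proof.
move=> /eqP hA nvA.
have rank_add_row p k (B : 'M[K]_(p, k)) (u : 'rV_k) :
    ~~ (u <= B)%MS -> \rank (col_mx u B) = (\rank B).+1.
  move=> nuB; rewrite -addsmxE mxrank_disjoint_sum.
    by rewrite rank_rV; case: eqP nuB => [->|]; rewrite ?sub0mx.
  apply/eqP; rewrite -mxrank_eq0 eqn0Ngt; apply: contra nuB => r_gt0.
  have ru : (\rank u <= \rank (u :&: B)%MS)%N.
    by apply: leq_trans r_gt0; rewrite rank_rV; case: (u == 0).
  by apply: submx_trans (capmxSr u B); rewrite -(geq_leqif (mxrank_leqif_sup (capmxSl u B))).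
have nvA' : ~~ (map_mx s v <= A^T)%MS.
  apply: contra nvA => /submxP[w eqv]; apply/submxP; exists (map_mx s w).
  have -> : v = map_mx s (map_mx s v) by apply/matrixP => i j; rewrite !mxE conjK.
  by rewrite eqv map_mxM -[in RHS]hA.
rewrite /bordered /block_mx /= rank_add_row.
  rewrite -[\rank (row_mx _ _)]mxrank_tr tr_row_mx /adjoint map_trmx trmxK.
  by rewrite rank_add_row // mxrank_tr.
apply: contra nvA => /submxP[w]; rewrite mul_mx_row => /eq_row_mx[_ ->].
exact: submxMl.
Qed.

Local Notation Q := (q%:R ^+ 2 : rat).

Lemma card_conj_fixedE : #|[pred z | s z == z]| = q.
Proof.
rewrite -[RHS](card_conj_fixed cardK).
by apply: eq_card => z; rewrite !inE sE.
Qed.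

Lemma card_row_space m n (A : 'M[K]_(m, n)) :
  #|[pred v : 'rV_n | (v <= A)%MS]|%:R = Q ^+ \rank A.
Proof.
rewrite -exprM -natrX expnM -cardK -card_rowg; congr _%:R.
by apply: eq_card => v; rewrite mem_rowg !inE.
Qed.

(** The terms stand for [v] in the row space with the one corner that keeps the rank, [v] in the row
    space with one of the other q - 1 corners, and [v] outside it with any of the q corners. The
    test function [phi] lets one identity serve both the rank distribution and the plain count. *)
Lemma sum_rank_bordered m (A : 'M[K]_m) (phi : nat -> rat) : hermitian A ->
  \sum_v \sum_(d | s d == d) phi (\rank (bordered (d, v, A)))
    = Q ^+ \rank A * phi (\rank A)
      + Q ^+ \rank A * (q%:R - 1) * phi (\rank A).+1
      + q%:R * (Q ^+ m - Q ^+ \rank A) * phi (\rank A).+2.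
Proof.
move=> hA; rewrite (bigID (fun v => (v <= A)%MS)) /=; congr (_ + _).
  rewrite -mulrA -mulrDr -card_row_space mulr_natl -sumr_const.
  apply: eq_bigr => v /submxP[w eqv].
  set e := (w *m A *m w^h) 0 0.
  have eE : w *m A *m w^h = e%:M by rewrite -mx11_scalar.
  have se : s e == e.
    have /matrixP/(_ 0 0) : (e%:M : 'M_1)^h = e%:M.
      by rewrite -eE !adjointM adjointK (eqP hA) mulmxA.
    by rewrite adjoint_scalar !mxE !mulr1n => ->.
  rewrite (bigD1 e) //= (rank_bordered_in _ hA eqv) eE eqxx addn0.
  congr (_ + _).
  rewrite (eq_bigr (fun=> phi (\rank A).+1)); last first.
    move=> d /andP[_ ne]; rewrite (rank_bordered_in _ hA eqv) eE.
    have -> : (d%:M != e%:M :> 'M_1).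
      by apply: contra ne => /eqP/matrixP/(_ 0 0); rewrite !mxE !mulr1n => ->.
    by rewrite addn1.
  rewrite sumr_const -[phi _ *+ _]mulr_natl; congr (_ * _).
  rewrite -(card_conj_fixedE) [in RHS](cardD1 e) inE se natrD addrAC subrr add0r.
  by congr _%:R; apply: eq_card => d; rewrite !inE andbC.
rewrite (eq_bigr (fun=> q%:R * phi (\rank A).+2)); last first.
  move=> v nvA; rewrite (eq_bigr (fun=> phi (\rank A).+2)).
    by rewrite sumr_const -[phi _ *+ _]mulr_natl card_conj_fixedE.
  by move=> d _; rewrite rank_bordered_notin.
rewrite sumr_const -[_ *+ #|_|]mulr_natl mulrA; congr (_ * _); rewrite [RHS]mulrC.
congr (_ * _).
have := cardC [pred v : 'rV[K]_m | (v <= A)%MS].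
move=> /(congr1 (fun k => k%:R : rat)); rewrite natrD card_row_space.
rewrite card_mx mul1n cardK -expnM natrX exprM => <-; rewrite addrAC subrr add0r.
by congr _%:R; apply: eq_card.
Qed.

Lemma sum_hermitian_rec m (phi : nat -> rat) :
  \sum_(B : 'M[K]_(1 + m) | hermitian B) phi (\rank B)
  = \sum_(A : 'M[K]_m | hermitian A)
     (Q ^+ \rank A * phi (\rank A)
      + Q ^+ \rank A * (q%:R - 1) * phi (\rank A).+1
      + q%:R * (Q ^+ m - Q ^+ \rank A) * phi (\rank A).+2).
Proof.
under [RHS]eq_bigr => A hA do rewrite -(sum_rank_bordered _ hA).
rewrite (reindex_onto (@bordered m) (fun B => (B 0 0, ursubmx B, drsubmx B)));
  last by move=> B hB; rewrite -hermitian_unborder.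
rewrite (eq_bigl (fun t : K * 'rV[K]_m * 'M[K]_m =>
  (s t.1.1 == t.1.1) && hermitian t.2)) => [|t]; last first.
  rewrite -hermitian_bordered; case: (boolP (hermitian _)) => //= hB.
  by apply/eqP/bordered_inj; rewrite -hermitian_unborder.
under [RHS]eq_bigr do rewrite exchange_big /= pair_big /=.
rewrite exchange_big /= pair_big /=.
by apply: eq_big => [[[d v] A]|[[d v] A] _] //=; rewrite andbT.
Qed.

End HermitianMatrices.

(** * Recursions for the numbers f_j *)

Section Frequencies.
Variables (q : nat) (q1 : (1 < q)%N).
Local Notation b := (- q%:R : rat).

Lemma expNq_neq1 j : b ^+ j.+1 - 1 != 0.
Proof.
rewrite subr_eq0; apply/eqP => /(congr1 Num.norm).
rewrite normrX normrN normr_nat normr1 -natrX => /eqP.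
by rewrite pnatr_eq1 -[1%N](exp1n j.+1) eqn_exp2r //; case: (q) q1 => [|[]].
Qed.

Lemma Nq_neq0 : b != 0.
Proof. by rewrite oppr_eq0 pnatr_eq0; case: (q) q1. Qed.

Let D j := \prod_(0 <= i < j) (b ^+ j - b ^+ i).

Let D_recS j : D j.+1 = (b ^+ j.+1 - 1) * b ^+ j * D j.
Proof.
rewrite /D big_nat_recl // expr0 -mulrA; congr (_ * _).
under eq_big_nat => i _ do rewrite !exprS -mulrBr.
by rewrite big_split /= prodr_const_nat subn0.
Qed.

Let D_neq0 j : D j != 0.
Proof.
elim: j => [|j IH]; first by rewrite /D big_nil oner_neq0.
by rewrite D_recS !mulf_neq0 ?expNq_neq1 ?expf_neq0 ?Nq_neq0.
Qed.

(** With b = -q, the terms (-1)^(m+1) q^m and (-1)^(l+1) q^l are -b^m and -b^l, so the two numerator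
    products merge. *)
Let freqE m j : freq q m j =
  (\prod_(0 <= i < j) (- (b ^+ m - b ^+ i) * (b ^+ m + b ^+ i))) / D j.
Proof.
rewrite /freq !big_split /= [X in _ * X]/= -/(D j).
have -> : \prod_(0 <= i < j) (b ^+ j - b ^+ i)^-1 = (D j)^-1.
  by rewrite prodfV.
rewrite mulrAC; congr (_ / _); rewrite -!big_split /=.
apply: eq_bigr => i _; rewrite addn1 !exprS addn1 exprS ![b ^+ _]exprNn.
ring.
Qed.

Lemma freq0 m : freq q m 0 = 1.
Proof. by rewrite /freq !big_nil mulr1. Qed.

Lemma freq_recr m j :
  freq q m j.+1 = freq q m j *
    ((b ^+ j) ^+ 2 - (b ^+ m) ^+ 2) / ((b ^+ j.+1 - 1) * b ^+ j).
Proof.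
rewrite !freqE big_nat_recr //= D_recS.
have := D_neq0 j; have := expNq_neq1 j; have := expf_neq0 j Nq_neq0.
by move=> h1 h2 h3; field; rewrite h1 h2 h3.
Qed.

(** The factor at index 0 splits off, and each remaining factor for (m + 1, i + 1) is b^2 times the
    one for (m, i). *)
Lemma freq_recl m j :
  freq q m.+1 j.+1 = freq q m j *
    (1 - (b ^+ m.+1) ^+ 2) * b ^+ j / (b ^+ j.+1 - 1).
Proof.
rewrite !freqE big_nat_recl //= D_recS expr0.
under eq_big_nat => i _.
  rewrite (_ : _ * _ = b ^+ 2 * (- (b ^+ m - b ^+ i) * (b ^+ m + b ^+ i)));
    last by rewrite !exprS; ring.
  over.
rewrite big_split /= prodr_const_nat subn0 exprAC.
have := D_neq0 j; have := expNq_neq1 j; have := expf_neq0 j Nq_neq0.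
by move=> h1 h2 h3; field; rewrite h1 h2 h3.
Qed.

Lemma freq_gt m j : (m < j)%N -> freq q m j = 0.
Proof.
move=> /subnKC <-; elim: (j - _)%N => [|k IH].
  by rewrite addn0 freq_recr subrr mulr0 mul0r.
by rewrite addnS freq_recr IH !mul0r.
Qed.

Local Notation Q := (q%:R ^+ 2 : rat).

Lemma freq_rec1 m : freq q m.+1 1 = Q * freq q m 1 + (q%:R - 1).
Proof.
rewrite freq_recl freq_recr freq0 !mul1r !expr1 (exprS _ m) expr0.
have := expNq_neq1 0; rewrite expr1 -[q%:R]opprK; move: (b ^+ m) b => M c h.
by field.
Qed.

(** The coefficients are those of [sum_rank_bordered]: rank r + 2 is reached from inner ranks r + 2,
    r + 1 and r. Once all frequencies are expressed through [freq q m r], this is a rational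
    identity in b, b^m and b^r. *)
Lemma freq_rec2 m r :
  freq q m.+1 r.+2 = Q ^+ r.+2 * freq q m r.+2
    + Q ^+ r.+1 * (q%:R - 1) * freq q m r.+1
    + q%:R * (Q ^+ m - Q ^+ r) * freq q m r.
Proof.
rewrite freq_recl !freq_recr.
have h1 := Nq_neq0; have h2 := expNq_neq1 r; have h3 := expNq_neq1 r.+1.
have h4 := expf_neq0 r Nq_neq0; move: (freq _ _ _) => g.
have QE k : Q ^+ k = (b ^+ k) ^+ 2 by rewrite -(sqrrN q%:R) exprAC.
rewrite !QE; rewrite !(exprS b) in h2 h3 *; have qE : q%:R = - b by rewrite opprK.
move: (b) qE h1 h2 h3 h4 => c -> h1 h2 h3 h4.
by move: (c ^+ m) (c ^+ r) h2 h3 h4 => M y h2 h3 h4; field; rewrite h1 h2 h3 h4.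
Qed.

End Frequencies.

(** * The number of Hermitian matrices of each rank *)

Section RankDistribution.
Variables (K : finFieldType) (q : nat) (cardK : #|K| = (q ^ 2)%N).
Variables (s : {rmorphism K -> K}) (sE : forall z, s z = z ^+ q).

(** Induction on m: bordering raises the rank by 0, 1 or 2, and regrouping by the final rank yields
    the recursions for [freq]. *)
Lemma sum_hermitian_rank m (phi : nat -> rat) :
  \sum_(A : 'M[K]_m | hermitian s A) phi (\rank A)
  = \sum_(0 <= r < m.+1) freq q m r * phi r.
Proof.
elim: m phi => [|m IH] phi.
  rewrite big_nat1 freq0 mul1r (bigD1 0) /=.
    by rewrite mxrank0 big1 ?addr0 // => A /andP[_]; rewrite [A]flatmx0 eqxx.
  by apply/eqP/matrixP => -[].
rewrite (sum_hermitian_rec cardK sE) (IH (fun r => q%:R ^+ 2 ^+ r * phi r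
  + q%:R ^+ 2 ^+ r * (q%:R - 1) * phi r.+1
  + q%:R * (q%:R ^+ 2 ^+ m - q%:R ^+ 2 ^+ r) * phi r.+2)).
have q1 := q_gt1 cardK.
have split2 (u : nat -> rat) : \sum_(0 <= r < m.+3) u r
    = u 0%N + u 1%N + \sum_(0 <= r < m.+1) u r.+2.
  by rewrite big_nat_recl // big_nat_recl // addrA.
(* The sums are aligned by adding terms whose rank exceeds the matrix size, where [freq]
   vanishes. *)
pose c r := freq q m.+1 r * phi r; rewrite -[RHS]/(\sum_(0 <= r < m.+2) c r).
have -> : \sum_(0 <= r < m.+2) c r = \sum_(0 <= r < m.+3) c r.
  by rewrite [RHS]big_nat_recr // [c m.+2]/c freq_gt // mul0r /= addr0.
rewrite split2.
pose u r := freq q m r * (q%:R ^+ 2 ^+ r * phi r).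
pose v r := freq q m r * (q%:R ^+ 2 ^+ r * (q%:R - 1) * phi r.+1).
pose w r := freq q m r *
  (q%:R * (q%:R ^+ 2 ^+ m - q%:R ^+ 2 ^+ r) * phi r.+2).
rewrite (eq_bigr (fun r => u r + v r + w r)); last first.
  by move=> r _; rewrite /u /v /w; ring.
rewrite !big_split /=.
have -> : \sum_(0 <= r < m.+1) u r = \sum_(0 <= r < m.+3) u r.
  by rewrite [RHS]big_nat_recr // [in RHS]big_nat_recr // [u m.+2]/u [u m.+1]/u
             !freq_gt // !mul0r /= !addr0.
rewrite split2.
have -> : \sum_(0 <= r < m.+1) v r = v 0%N + \sum_(0 <= r < m.+1) v r.+1.
  by rewrite -(big_nat_recl _ _ v) // [RHS]big_nat_recr // [v m.+1]/v
             freq_gt // mul0r /= addr0.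
rewrite [in RHS](eq_bigr (fun r => u r.+2 + v r.+1 + w r)); last first.
  by move=> r _; rewrite /c /u /v /w (freq_rec2 q1); ring.
rewrite !big_split /= /c {1 2}/u {1}/v (freq_rec1 q1) !freq0 !expr0 !expr1.
ring.
Qed.

Lemma card_hermitian m : #|[set A : 'M[K]_m | hermitian s A]| = (q ^ (m ^ 2))%N.
Proof.
apply/eqP; rewrite -(eqr_nat rat) -sum1_card natr_sum.
under eq_bigl do rewrite inE.
elim: m => [|m IH].
  rewrite (bigD1 0) /=; last by apply/eqP/matrixP => -[].
  by rewrite big1 ?addr0 // => A /andP[_]; rewrite [A]flatmx0 eqxx.
rewrite (sum_hermitian_rec cardK sE _ (fun=> 1)).
(* For constant [phi] the three coefficients add up to the number q^(2m+1) of possible borders. *)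
rewrite (eq_bigr (fun=> q%:R ^+ (2 * m + 1) * 1)) => [|A _]; last first.
  rewrite exprD exprM; ring.
rewrite -big_distrr /= (eqP IH) -natrX -natrM -expnD eqr_nat; apply/eqP.
congr (_ ^ _)%N; nia.
Qed.

End RankDistribution.

(** * Level sets of Hermitian forms *)

Section ZeroCount.
Variables (K : finFieldType) (q : nat) (cardK : #|K| = (q ^ 2)%N).
Variables (s : {rmorphism K -> K}) (sE : forall z, s z = z ^+ q).
Local Notation "A ^h" := (adjoint s A) (at level 1, format "A ^h").
Local Notation Q := (q%:R ^+ 2 : rat).

Definition sesqui m (A : 'M[K]_m) (u v : 'rV[K]_m) : K := (u *m A *m v^h) 0 0.
Definition hform m (A : 'M[K]_m) (v : 'rV[K]_m) : K := sesqui A v v.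

Lemma sesqui_swap m (A : 'M[K]_m) u v :
  hermitian s A -> sesqui A v u = s (sesqui A u v).
Proof.
move=> /eqP hA; rewrite /sesqui -[v in LHS](adjointK cardK sE) -{1}hA.
by rewrite -mulmxA -!adjointM !mxE.
Qed.

Lemma hform_fixed m (A : 'M[K]_m) v : hermitian s A -> s (hform A v) = hform A v.
Proof. by move=> hA; rewrite /hform -sesqui_swap. Qed.

Lemma hformD m (A : 'M[K]_m) u v : hermitian s A ->
  hform A (u + v) = hform A u + (sesqui A u v + s (sesqui A u v)) + hform A v.
Proof.
move=> hA; rewrite -(sesqui_swap _ _ hA) /hform /sesqui adjointD.
rewrite !mulmxDl !mulmxDr !mxE; ring.
Qed.

Lemma hformZ m (A : 'M[K]_m) c v : hform A (c *: v) = c ^+ q.+1 * hform A v.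
Proof.
by rewrite /hform /sesqui adjointZ -!scalemxAl -scalemxAr scalerA mxE sE exprS.
Qed.

(** Each fibre of a nonzero linear form is a translate of its kernel, of dimension m - 1. *)
Lemma card_linear_fibre m (c : 'cV[K]_m) (k : K) : c != 0 ->
  #|[pred z : 'rV_m | (z *m c) 0 0 == k]|%:R = Q ^+ m.-1.
Proof.
move=> c0; have rc : \rank c = 1%N.
  by rewrite -mxrank_tr rank_rV trmx_eq0 c0.
have [z0 z0E] : exists z0 : 'rV_m, z0 *m c = k%:M.
  have : (k%:M <= c)%MS.
    by apply: submx_full; rewrite /row_full rc.
  by case/submxP => z0 ->; exists z0.
have <- : \rank (kermx c) = m.-1 by rewrite mxrank_ker rc subn1.
rewrite -(card_row_space cardK); congr _%:R.
rewrite -[RHS](card_imset _ (addIr z0)); apply: eq_card => z; rewrite inE.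
apply/eqP/imsetP => [zE|[y]].
  exists (z - z0); rewrite ?subrK // inE sub_kermx mulmxBl z0E subr_eq0.
  by rewrite [z *m c]mx11_scalar zE.
by rewrite inE sub_kermx => /eqP yc ->; rewrite mulmxDl yc add0r z0E mxE mulr1n.
Qed.

(** [S] is partitioned by leading coordinate; scaling by c maps the part with value 1 bijectively
    onto the part with value c. *)
Lemma dvdn_card_cone m (S : {set 'rV[K]_m}) : 0 \notin S ->
  (forall c v, c != 0 -> v \in S -> c *: v \in S) -> (#|K|.-1 %| #|S|)%N.
Proof.
move=> S0 SZ.
(* The index picked depends only on the support, so nonzero multiples of [v] share it; the default 0
   occurs only at [v = 0]. *)
pose lead (v : 'rV[K]_m) := if [pick i | v 0 i != 0] is Some i then v 0 i else 0.
have leadZ c v : c != 0 -> lead (c *: v) = c * lead v.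
  move=> c0; rewrite /lead (@eq_pick _ _ (fun i => v 0 i != 0)) => [|i].
    by case: pickP => [i _|_]; rewrite ?mxE ?mulr0.
  by rewrite !mxE mulf_eq0 (negPf c0).
have lead0 v : v \in S -> lead v != 0.
  rewrite /lead; case: pickP => // v0 vS; case/negP: S0.
  suff <- : v = 0 by [].
  by apply/rowP => i; have := v0 i; rewrite mxE => /negbFE/eqP.
have fib c : c != 0 ->
    #|[set v in S | lead v == c]| = #|[set v in S | lead v == 1]|.
  move=> c0; rewrite -[RHS](card_imset _ (scalerI c0)); apply: eq_card => v.
  rewrite inE; apply/andP/imsetP => [[vS /eqP lv]|[u]].
    exists (c^-1 *: v); last by rewrite scalerA mulfV // scale1r.
    by rewrite inE SZ ?invr_eq0 //= leadZ ?invr_eq0 // lv mulVf.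
  by rewrite inE => /andP[uS /eqP lu] ->; rewrite SZ // leadZ // lu mulr1.
rewrite -sum1_card (partition_big lead (fun c => c != 0)) //=.
rewrite (eq_bigr (fun=> #|[set v in S | lead v == 1]|)) => [|c c0].
  by rewrite sum_nat_const (cardC1 0) dvdn_mulr.
by rewrite -(fib c c0) -sum1_card; apply: eq_bigl => v; rewrite inE.
Qed.

Section Form.
Variables (m : nat) (A : 'M[K]_m) (hA : hermitian s A).

Let N a := #|[pred v | hform A v == a]|.

(** By surjectivity of the norm there is c with c^(q+1) = a, and scaling by c maps level 1 onto
    level a. *)
Let N_level a : a != 0 -> s a = a -> N a = N 1.
Proof.
rewrite sE => a0 /(norm_surj cardK a0)[c cE].
have c0 : c != 0 by apply: contra a0 => /eqP c0; rewrite -cE c0 expr0n.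
rewrite /N -[RHS](card_imset _ (scalerI c0)); apply: eq_card => v.
rewrite inE; apply/eqP/imsetP => [fv|[u]].
  exists (c^-1 *: v); last by rewrite scalerA mulfV // scale1r.
  by rewrite inE hformZ exprVn cE fv mulVf.
by rewrite inE => /eqP fu ->; rewrite hformZ fu mulr1.
Qed.

Let sum_levels (g : nat -> rat) :
  \sum_(a | s a == a) g (N a) = g (N 0) + (q%:R - 1) * g (N 1).
Proof.
rewrite (bigD1 0) ?rmorph0 //=; congr (_ + _).
rewrite (eq_bigr (fun=> g (N 1))) => [|a /andP[/eqP sa a0]]; last by rewrite N_level.
rewrite sumr_const -[_ *+ #|_|]mulr_natl; congr (_ * _).
rewrite -(card_conj_fixedE cardK sE) [in RHS](cardD1 0) inE rmorph0 eqxx natrD addrAC subrr add0r.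
by congr _%:R; apply: eq_card => d; rewrite !inE andbC.
Qed.

Let sum_N : (N 0)%:R + (q%:R - 1) * (N 1)%:R = Q ^+ m.
Proof.
rewrite -(sum_levels (fun k => k%:R)) -natr_sum -!natrX -expnM; congr _%:R.
rewrite expnM -cardK -[m in RHS]mul1n -card_mx -sum1_card.
rewrite (partition_big (hform A) (fun a => s a == a)) /=; last first.
  by move=> v _; rewrite hform_fixed.
by apply: eq_bigr => a _; rewrite /N -sum1_card; apply: eq_bigl => v; rewrite inE.
Qed.

(** The condition on z reads t + s t = - [hform A w] with t = [sesqui A z w]. It is void if w A = 0;
    otherwise it allows q values of t, each taken Q^(m-1) times. *)
Let card_shift w :
  #|[pred z | hform A (z + w) == hform A z]|%:R
    = if w *m A == 0 then Q ^+ m else q%:R * Q ^+ m.-1.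
Proof.
have shiftE z : (hform A (z + w) == hform A z)
    = (sesqui A z w + s (sesqui A z w) == - hform A w).
  rewrite hformD // -subr_eq0 -[RHS]subr_eq0 opprK; congr (_ == 0); ring.
case: eqP => [wA|/eqP wA].
  rewrite -exprM -natrX expnM -cardK -[m in RHS]mul1n -card_mx; congr _%:R.
  apply: eq_card => z; rewrite inE shiftE (sesqui_swap w z hA).
  by rewrite /hform /sesqui wA !mul0mx mxE rmorph0 rmorph0 addr0 oppr0 eqxx.
have Aw0 : A *m w^h != 0.
  by rewrite -(eqP hA) -adjointM adjoint_eq0.
rewrite -(card_linear_fibre 0 Aw0).
rewrite -sum1_card natr_sum.
rewrite (partition_big (fun z => sesqui A z w)
          (fun k => k + s k == - hform A w)) /=; last first.
  by move=> z; rewrite inE shiftE.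
rewrite (eq_bigr (fun=> Q ^+ m.-1)) => [|k kE].
  rewrite sumr_const (card_linear_fibre 0 Aw0) -[_ *+ #|_|]mulr_natl.
  congr (_%:R * _).
  have fw : (- hform A w) ^+ q = - hform A w by rewrite -sE rmorphN hform_fixed.
  rewrite -[RHS](card_trace_fibre cardK fw).
  by apply: eq_card => k; rewrite [RHS]inE -sE.
rewrite -(card_linear_fibre k Aw0) -sum1_card natr_sum.
apply: eq_bigl => z; rewrite !inE shiftE mulmxA -/(sesqui A z w).
by case: (sesqui A z w =P k) => [->|]; rewrite ?kE ?andbF.
Qed.

(** Pairs (u, v) with equal form values are counted by their common value on the left, and by the
    difference w = v - u through [card_shift] on the right. *)
Let sum_N2 : (N 0)%:R ^+ 2 + (q%:R - 1) * (N 1)%:R ^+ 2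
  = Q ^+ (m - \rank A) * Q ^+ m + (Q ^+ m - Q ^+ (m - \rank A)) * (q%:R * Q ^+ m.-1).
Proof.
rewrite -(sum_levels (fun k => k%:R ^+ 2)).
transitivity (\sum_u \sum_(v | hform A u == hform A v) (1 : rat)).
  rewrite (partition_big (hform A) (fun a => s a == a)) /=; last first.
    by move=> v _; rewrite hform_fixed.
  apply: eq_bigr => a _; rewrite expr2 mulr_natl -sumr_const.
  apply: eq_big => [u|u /eqP fu]; first by rewrite inE.
  rewrite /N -sum1_card natr_sum; apply: eq_bigl => v.
  by rewrite inE -fu eq_sym.
transitivity (\sum_w #|[pred z | hform A (z + w) == hform A z]|%:R : rat).
  under [RHS]eq_bigr do rewrite -sum1_card natr_sum big_mkcond.
  rewrite [RHS]exchange_big /=; apply: eq_bigr => z _.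
  rewrite big_mkcond (reindex_inj (addrI z)) /=.
  by apply: eq_bigr => w _; rewrite inE eq_sym.
under eq_bigr do rewrite card_shift.
rewrite (bigID (fun w => w *m A == 0)) /=.
have cR : #|[pred w : 'rV_m | w *m A == 0]|%:R = Q ^+ (m - \rank A).
  rewrite -mxrank_ker -(card_row_space cardK); congr _%:R.
  by apply: eq_card => w; rewrite !inE sub_kermx.
congr (_ + _).
  rewrite (eq_bigr (fun=> Q ^+ m)) => [|w ->] //.
  by rewrite sumr_const -[_ *+ #|_|]mulr_natl cR.
rewrite (eq_bigr (fun=> q%:R * Q ^+ m.-1)) => [|w /negPf->] //.
rewrite sumr_const -[_ *+ #|_|]mulr_natl; congr (_ * _); rewrite -cR.
have := cardC [pred w : 'rV[K]_m | w *m A == 0].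
move=> /(congr1 (fun k => k%:R : rat)); rewrite natrD.
rewrite card_mx mul1n cardK -expnM natrX exprM => <-; rewrite addrAC subrr add0r.
by congr _%:R; apply: eq_card.
Qed.

(* The nonzero isotropic vectors form a cone, so q^2 - 1 divides N 0 - 1 =
   (q^(2m) - 1) - (q - 1) N 1. *)
Let dvd_N1 : (q.+1 %| N 1%R)%N.
Proof.
have q1 := q_gt1 cardK.
have f0 : hform A 0 = 0 by rewrite -(scale0r 0) hformZ expr0n mul0r.
have d1 : (#|K|.-1 %| (N 0%R).-1)%N.
  have -> : (N 0%R).-1 = #|[set v | hform A v == 0] :\ 0|.
    have -> : N 0%R = #|[set v | hform A v == 0]| by rewrite cardsE.
    by rewrite (cardsD1 0 [set v | hform A v == 0]) inE f0 eqxx.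
  apply: dvdn_card_cone => [|c v c0]; first by rewrite !inE eqxx.
  rewrite !inE scaler_eq0 (negPf c0) /= => /andP[-> /eqP fv].
  by rewrite hformZ fv mulr0 eqxx.
have N0 : (0 < N 0%R)%N.
  by apply/card_gt0P; exists 0; rewrite inE f0.
have sN : (N 0%R + (q - 1) * N 1%R = #|K| ^ m)%N.
  apply/eqP; rewrite -(eqr_nat rat) natrD natrM natrB ?(ltnW q1) //.
  by rewrite sum_N cardK natrX natrX.
have d2 : (#|K|.-1 %| (#|K| ^ m).-1)%N by rewrite predn_exp dvdn_mulr.
have : (#|K|.-1 %| (q - 1) * N 1%R)%N.
  have <- : ((#|K| ^ m).-1 - (N 0%R).-1 = (q - 1) * N 1%R)%N.
    by rewrite -sN; case: (N 0%R) N0 => // k _; rewrite addSn addKn.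
  by rewrite dvdn_sub.
rewrite cardK (_ : (q ^ 2).-1 = (q - 1) * q.+1)%N; last nia.
by rewrite dvdn_pmul2l // subn_gt0.
Qed.

(** Since N 0 + (q - 1) N 1 = Q^m, only N 1 is unknown; the second moment gives N 0 - N 1 up to
    sign, and [dvd_N1] selects the sign. *)
Lemma card_hform_neq0 : (0 < m)%N ->
  #|[pred v | hform A v != 0]|%:R = weight q m (\rank A).
Proof.
move=> m0; have q1 := q_gt1 cardK; have rm := rank_leq_row A.
set r := \rank A in rm *.
have q0 : (q%:R != 0 :> rat) by rewrite pnatr_eq0 -lt0n ltnW.
have q10 : (q%:R - 1 != 0 :> rat) by rewrite subr_eq0 pnatr_eq1 gtn_eqF.
have Qm : Q ^+ m = q%:R * (q%:R * Q ^+ m.-1).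
  by rewrite mulrA -expr2 -exprS prednK.
(* By [sum_N] the left side is the square of N 0 - N 1. *)
have E2 : (Q ^+ m - q%:R * (N 1)%:R) ^+ 2 = ((-1) ^+ r * q%:R ^+ (2 * m - r)) ^+ 2.
  rewrite [in RHS]exprMn sqrr_sign mul1r -[in RHS]exprM.
  have -> : q%:R ^+ ((2 * m - r) * 2) = Q ^+ m * Q ^+ (m - r).
    by rewrite -exprD -exprM; congr (_ ^+ _); lia.
  apply: (mulfI q10); have := sum_N2; rewrite -/r.
  have -> : (N 0)%:R = Q ^+ m - (q%:R - 1) * (N 1)%:R.
    by rewrite -sum_N addrK.
  move/(congr1 (fun z => q%:R * z)).
  move: (Q ^+ (m - r)) (Q ^+ m.-1) (Q ^+ m) Qm => R' P M ->.
  by move: q%:R (N 1)%:R => c n1 h; lra.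
have [k N1E] := dvdnP dvd_N1.
have Eq : Q ^+ m - q%:R * (N 1)%:R = (-1) ^+ r * q%:R ^+ (2 * m - r).
  (* Modulo q + 1, where q is -1, the opposite sign would give 1 = -1, so that q + 1 >= 3 would
     divide 2. *)
  move/eqP: E2; rewrite eqf_sqr => /orP[/eqP //|/eqP Eneg].
  have Z : (q%:Z ^+ (2 * m) - q%:Z * (k%:Z * q.+1%:Z) = - ((-1) ^+ r * q%:Z ^+ (2 * m - r))).
    apply: (@intr_inj rat); rewrite rmorphB rmorphN !rmorphM /= !rmorphXn /= rmorphN1.
    by rewrite exprM -Eneg N1E natrM.
  have dvdX j : (q.+1 %| q%:Z ^+ j - (-1) ^+ j)%Z.
    rewrite subrXX (_ : q%:Z - -1 = q.+1%:Z) ?dvdz_mulr //; lia.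
  have s2 : (-1) ^+ (2 * m) = 1 :> int by rewrite exprM sqrrN !expr1n.
  have sr : (-1) ^+ r * (-1) ^+ (2 * m - r) = 1 :> int.
    by rewrite -exprD subnKC // (leq_trans rm) // leq_pmull.
  have : (q.+1 %| q%:Z * (k%:Z * q.+1%:Z) - (q%:Z ^+ (2 * m) - (-1) ^+ (2 * m))
       - (-1) ^+ r * (q%:Z ^+ (2 * m - r) - (-1) ^+ (2 * m - r)))%Z.
    apply: rpredB; last exact/dvdz_mull/dvdX.
    by apply: rpredB (dvdX _); exact/dvdz_mull/dvdz_mull/dvdzz.
  rewrite s2 mulrBr sr opprB addrA opprB addrA.
  have -> : q%:Z * (k%:Z * q.+1%:Z) + 1 - q%:Z ^+ (2 * m) + 1
      - (-1) ^+ r * q%:Z ^+ (2 * m - r) = 2.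
    by move: Z; lia.
  by rewrite dvdzE => /dvdn_leq => /(_ isT); lia.
have -> : #|[pred v | hform A v != 0]|%:R = Q ^+ m - (N 0)%:R.
  have := cardC [pred v | hform A v == 0].
  move=> /(congr1 (fun k => k%:R : rat)); rewrite natrD.
  rewrite card_mx mul1n cardK -expnM natrX exprM => <-; rewrite addrAC subrr add0r.
  by congr _%:R; apply: eq_card.
rewrite -sum_N addrAC subrr add0r /weight.
have e1 : q%:R ^+ (2 * m) = q%:R * q%:R ^+ (2 * m - 1) :> rat.
  by rewrite -exprS; congr (_ ^+ _); lia.
have e2 : q%:R ^+ (2 * m - r) = q%:R * q%:R ^+ (2 * m - r - 1) :> rat.
  by rewrite -exprS; congr (_ ^+ _); lia.
have -> : (N 1)%:R = q%:R ^+ (2 * m - 1) - (-1) ^+ r * q%:R ^+ (2 * m - r - 1) :> rat.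
  apply: (mulfI q0); rewrite mulrBr mulrCA -e1 -e2 -Eq -exprM; ring.
rewrite e1; ring.
Qed.

End Form.
End ZeroCount.

(** * Cyclic codes as spaces of multiples of the generator *)

Section CyclicCodes.
Variables (F : finFieldType) (n : nat) (n0 : (0 < n)%N).
Variables (g : {poly F}) (gX : g %| 'X^n - 1).

Lemma monic_Xn_sub1 : 'X^n - 1 \is @monic F.
Proof. exact: monicXnsubC. Qed.

Lemma size_Xn_sub1 : size ('X^n - 1 : {poly F}) = n.+1.
Proof. exact: size_XnsubC. Qed.

Lemma generator_neq0 : g != 0.
Proof. exact: dvdpN0 gX (monic_neq0 monic_Xn_sub1). Qed.

Lemma in_qpoly_eq0 (p : {poly F}) :
  (in_qpoly ('X^n - 1) p == 0) = ('X^n - 1 %| p).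
Proof.
rewrite -val_eqE /= /mk_monic size_Xn_sub1 monic_Xn_sub1 ltnS n0 /=.
by rewrite Pdiv.Idomain.dvdpE.
Qed.

(** As g divides X^n - 1, reduction modulo X^n - 1 does not affect divisibility by g. *)
Lemma mem_cyclic_code (c : 'rV[F]_n) :
  (c \in cyclic_code n g) = (g %| rVpoly c).
Proof.
rewrite inE; apply/existsP/idP => [[a]|/dvdpP[a ->]]; last first.
  by exists (qclass n a); rewrite /qclass in_qpolyM.
have -> : a = qclass n a :> {poly %/ _}.
  by apply/val_inj/esym/in_qpoly_small/size_mk_monic.
rewrite /qclass -in_qpolyM -subr_eq0 -raddfB in_qpoly_eq0 => /(dvdp_trans gX).
by rewrite dvdp_subl // dvdp_mull.
Qed.

(** The code is the injective image of u -> u g on polynomials of degree below n - deg g. *)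
Lemma cyclic_code_vspace : exists V : {vspace 'rV[F]_n},
  cyclic_code n g =i V /\ \dim V = (n - (size g).-1)%N.
Proof.
set k := (n - _)%N.
have sg : ((size g).-1 <= n)%N.
  by rewrite -ltnS prednK ?size_poly_gt0 ?generator_neq0 // -size_Xn_sub1
             dvdp_leq // monic_neq0 // monic_Xn_sub1.
pose f (u : 'rV[F]_k) : 'rV[F]_n := poly_rV (rVpoly u * g).
have f_lin : linear f by move=> a u v; rewrite /f !linearP /= mulrDl -scalerAl linearP.
pose fL : {linear 'rV[F]_k -> 'rV[F]_n} := HB.pack f
  (GRing.isLinear.Build _ _ _ _ f f_lin).
(* The product has size at most n, so [poly_rV] truncates nothing. *)
have fK u : rVpoly (f u) = rVpoly u * g.
  rewrite poly_rV_K //; have [->|u0] := eqVneq (rVpoly u) 0.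
    by rewrite mul0r size_poly0.
  rewrite size_mul ?generator_neq0 //.
  have su : (size (rVpoly u) <= k)%N by exact: size_poly.
  have := size_poly_gt0 g; rewrite generator_neq0 => sg0.
  by rewrite -(prednK sg0) addnS /= -(subnK sg) leq_add2r.
exists (limg (linfun fL)); split=> [c|].
  rewrite mem_cyclic_code; apply/idP/memv_imgP => [/dvdpP[a aE]|[u _ ->]].
    exists (poly_rV a); rewrite ?memvf // lfunE /=.
    apply: (can_inj rVpolyK); rewrite fK aE poly_rV_K //.
    have [->|a0] := eqVneq a 0; first by rewrite size_poly0.
    have sc : (size (rVpoly c) <= n)%N by exact: size_poly.
    have sg0 : (0 < size g)%N by rewrite size_poly_gt0 generator_neq0.
    move: sc; rewrite aE size_mul ?generator_neq0 // -(prednK sg0) addnS /=.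
    by rewrite /k leq_subRL // addnC.
  by rewrite lfunE /= fK dvdp_mull.
rewrite limg_dim_eq ?dimvf /dim /= ?mul1n //.
apply/eqP; rewrite capfv -subv0; apply/subvP => u.
rewrite memv_ker memv0 => /eqP; rewrite (lfunE fL) => fu.
have : rVpoly (f u) == 0 by rewrite [f u]fu linear0.
rewrite fK mulf_eq0 (negPf generator_neq0) orbF => /eqP u0.
by apply/eqP/(can_inj rVpolyK); rewrite u0 linear0.
Qed.

End CyclicCodes.

(** * The least nonzero weight *)

Section Weights.
Variables (q m : nat) (q1 : (1 < q)%N).
Local Notation qr := (q%:R : rat).

Lemma weight0 : (0 < m)%N -> weight q m 0 = 0.
Proof.
move=> m0; rewrite /weight subn0 expr0 mul1r.
have -> : qr ^+ (2 * m) = qr * qr ^+ (2 * m - 1).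
  by rewrite -exprS; congr (_ ^+ _); lia.
ring.
Qed.

Lemma weight2E : (1 < m)%N ->
  weight q m 2 = (qr ^+ (2 * m) - qr ^+ (2 * m - 1)) * (1 - qr ^- 2).
Proof.
move=> m1; have q0 : qr != 0 by rewrite pnatr_eq0 -lt0n ltnW.
rewrite /weight sqrrN expr1n mul1r.
have -> : qr ^+ (2 * m) = qr * (qr ^+ 2 * qr ^+ (2 * m - 2 - 1)).
  by rewrite -exprD -exprS; congr (_ ^+ _); lia.
have -> : qr ^+ (2 * m - 1) = qr ^+ 2 * qr ^+ (2 * m - 2 - 1).
  by rewrite -exprD; congr (_ ^+ _); lia.
by move: (qr ^+ (_ - 1)) => P; field.
Qed.

Lemma weight2_gt0 : (1 < m)%N -> 0 < weight q m 2.
Proof.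
move=> m1; rewrite weight2E // mulr_gt0 // subr_gt0.
  by rewrite ltr_eXn2l ?ltr1n //; lia.
by rewrite invf_lt1 ?exprn_gt0 ?ltr0n ?(ltnW q1) // exprn_egt1 ?ltr1n.
Qed.

(** For odd r the correction term raises the weight; for even r it lowers it by an amount that
    decreases with r. *)
Lemma weight2_le r : (0 < r)%N -> (r <= m)%N -> weight q m 2 <= weight q m r.
Proof.
move=> r0 rm; rewrite /weight lerD2l lerN2 ler_wpM2r ?subr_ge0 ?ler1n ?(ltnW q1) //.
rewrite sqrrN expr1n mul1r -signr_odd.
have [odd_r|even_r] := boolP (odd r).
  rewrite expr1 mulN1r (@le_trans _ _ 0) ?oppr_le0 ?exprn_ge0 ?ler0n //.
rewrite expr0 mul1r ler_eXn2l ?ltr1n //.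
by case: r r0 even_r {rm} => [|[|r]] // _ _; lia.
Qed.

End Weights.

(** * Roots of unity, Frobenius and subfields in finite extensions *)

Lemma mem_image_finField (K : finFieldType) (L : fieldType)
    (f : {rmorphism K -> L}) (z : L) :
  z ^+ #|K| = z -> exists k, f k = z.
Proof.
move=> zK; have /(congr1 (fun p => root (map_poly f p) z)) := finField_genPoly K.
rewrite rmorphB /= map_polyXn map_polyX rootE !hornerE zK subrr eqxx.
move=> /esym; rewrite rmorph_prod /= rootE horner_prod => /prodf_eq0[k _].
by rewrite map_polyXsubC !hornerE subr_eq0 => /eqP ->; exists k.
Qed.

Lemma primitive_root_neq0 (R : idomainType) n (z : R) :
  n.-primitive_root z -> z != 0.
Proof.
move=> prim_z; apply/eqP => z0; have := prim_expr_order prim_z.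
rewrite z0 expr0n gtn_eqF ?(prim_order_gt0 prim_z) //.
by move/eqP; rewrite eq_sym oner_eq0.
Qed.

Lemma sum_expr_unity (R : idomainType) n (w : R) :
  w ^+ n = 1 -> w != 1 -> \sum_(j < n) w ^+ j = 0.
Proof.
move=> wn w1; apply: (mulfI (_ : w - 1 != 0)); first by rewrite subr_eq0.
by rewrite -subrX1 wn subrr mulr0.
Qed.

Lemma card_finvect (F : finFieldType) (vT : vectType F) :
  #|finvect_type vT| = (#|F| ^ \dim {:vT})%N.
Proof.
pose V : vectType F := finvect_type vT.
by rewrite -(@card_vspacef F (finvect_type vT) (Vector.class V)) card_vspace.
Qed.

Section FiniteExtension.
Variables (F : finFieldType) (L : fieldExtType F).
Local Notation q := #|F|.
Local Notation N := (\dim {:L}).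

Lemma expr_card_ext (y : L) : y ^+ (q ^ N) = y.
Proof. by apply/eqP; rewrite -Fermat's_little_theorem memvf. Qed.

Lemma pnat_pchar_ext : [pchar L].-nat q.
Proof.
rewrite (eq_pnat _ (fmorph_pchar (in_alg L))); exact: pnat_pchar_card.
Qed.

(** The q-th power map fixes the coefficients, which come from [F], so it maps roots to roots. *)
Lemma root_frobenius (p : {poly F}) (z : L) a :
  root (map_poly (in_alg L) p) z -> root (map_poly (in_alg L) p) (z ^+ (q ^ a)).
Proof.
move=> pz; elim: a => [|a IH]; first by rewrite expn0 expr1.
have [s sE] := exists_frobenius pnat_pchar_ext.
rewrite expnSr exprM -sE; have := rmorph_root s IH.
rewrite -map_poly_comp (eq_map_poly (_ : _ =1 in_alg L)) // => c.
by rewrite [LHS]sE -rmorphXn expf_card.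
Qed.

(** If x has order d, all q^N - 1 nonzero elements are powers of x, hence d-th roots of unity, of
    which there are at most d. *)
Lemma mul_generator_primitive (x : L) : is_mul_generator x ->
  (q ^ N - 1)%N.-primitive_root x.
Proof.
case=> x0 gen.
have q1 : (1 < q)%N := finNzRing_gt1 F.
have N0 : (0 < N)%N by rewrite adim_gt0.
have n0 : (0 < q ^ N - 1)%N by rewrite subn_gt0 -(expn0 q) ltn_exp2l.
have xn : x ^+ (q ^ N - 1) = 1.
  apply: (mulfI x0); rewrite mulr1 -exprS subn1 prednK ?expr_card_ext //.
  by rewrite expn_gt0 ltnW.
have [d prim_d d_n] := prim_order_exists n0 xn.
suff le_nd : (q ^ N - 1 <= d)%N.
  by rewrite (_ : (q ^ N - 1)%N = d) //; apply/eqP; rewrite eqn_leq le_nd dvdn_leq.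
pose rs : seq L := enum (predC1 (0 : finvect_type L)).
have urs : uniq rs by exact: enum_uniq.
have -> : (q ^ N - 1)%N = size rs.
  rewrite [RHS](_ : _ = #|predC1 (0 : finvect_type L)|); last by rewrite cardE.
  rewrite cardC1 -subn1; congr (_ - _)%N.
  by rewrite card_finvect.
apply: (@max_unity_roots L d rs (prim_order_gt0 prim_d) _ urs).
apply/allP => y yrs; rewrite unity_rootE.
have y0 : y != 0.
  have : (y : finvect_type L) \in enum (predC1 (0 : finvect_type L)) by exact: yrs.
  by rewrite mem_enum.
have [k ->] := gen y y0.
by rewrite exprnP exprzAC -exprnP prim_expr_order // exp1rz.
Qed.

(** The subfield is F(z) for a power z of x of order q^2 - 1. *)
Lemma exists_quadratic_subfield (m : nat) (x : L) : (0 < m)%N ->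
  (q ^ (2 * m) - 1)%N.-primitive_root x ->
  exists (K : finFieldType) (iota : {rmorphism K -> L}), #|K| = (q ^ 2)%N.
Proof.
move=> m0 prim_x.
have q1 : (1 < q)%N := finNzRing_gt1 F.
pose n := (q ^ (2 * m) - 1)%N.
have /dvdnP[k nE] : (q ^ 2 - 1 %| n)%N.
  by rewrite /n expnM !subn1 (predn_exp (q ^ 2) m) dvdn_mulr.
pose z := x ^+ k.
have prim_z : (q ^ 2 - 1)%N.-primitive_root z.
  have := exp_prim_root prim_x k; rewrite -/n.
  have k0 : (0 < k)%N by move: (prim_order_gt0 prim_x); rewrite -/n nE muln_gt0 => /andP[].
  by rewrite nE gcdnMr mulKn.
pose E := <<1; z>>%AS.
have zE : z \in E by exact: memv_adjoin.
have q2 : (0 < q ^ 2 - 1)%N by rewrite subn_gt0 -(expn0 q) ltn_exp2l.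
have dE : \dim E = 2%N.
  have d0 : (0 < \dim E)%N by rewrite adim_gt0.
  apply/eqP; rewrite eqn_leq; apply/andP; split.
    rewrite dim_Fadjoin dimv1 muln1 -ltnS -size_minPoly.
    have zq2 : (z ^+ q) ^+ q = z.
      rewrite -exprM mulnn -[in LHS](subnK (_ : 1 <= q ^ 2)%N) ?expn_gt0 ?(ltnW q1) //.
      by rewrite exprD (prim_expr_order prim_z) mul1r.
    (* Its coefficients involve z + z^q and z^(q+1), which the q-th power fixes as z^(q^2) = z; so p
       is defined over [F] and z has degree at most 2. *)
    pose p := ('X - z%:P) * ('X - (z ^+ q)%:P).
    have <- : size p = 3%N by rewrite size_mul ?polyXsubC_eq0 // !size_XsubC.
    apply: dvdp_leq; first by rewrite mulf_neq0 ?polyXsubC_eq0.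
    apply: minPoly_dvdp; last by rewrite rootM root_XsubC eqxx.
    have -> : p = 'X^2 - (z + z ^+ q)%:P * 'X + (z ^+ q.+1)%:P.
      rewrite /p (exprS z q) polyCM polyCD; ring.
    have memq (y : L) : y ^+ q = y -> y \in 1%VS.
      move=> yq; have := Fermat's_little_theorem 1%AS y.
      by rewrite dimv1 expn1 yq eqxx.
    rewrite rpredD ?rpredB ?rpredM ?polyOverXn ?polyOverX //= polyOverC memq //.
      by rewrite (exprDn_pchar _ _ pnat_pchar_ext) zq2 addrC.
    by rewrite exprS exprMn zq2 mulrC.
  (* Dimension 1 would give z^q = z, so q^2 - 1 would divide q - 1. *)
  rewrite leqNgt ltnS leq_eqVlt ltnS leqNgt d0 orbF; apply/negP => /eqP d1.
  move: zE; rewrite Fermat's_little_theorem d1 expn1 => /eqP zq.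
  have z0 := primitive_root_neq0 prim_z.
  have : z ^+ (q - 1) = 1.
    by apply: (mulfI z0); rewrite mulr1 -exprS subn1 prednK ?zq // ltnW.
  move/eqP; rewrite -(prim_order_dvd prim_z) => /dvdn_leq.
  by rewrite subn_gt0 q1 => /(_ isT); nia.
exists (finvect_type (subvs_of E)).
exists (vsval : {rmorphism subvs_of E -> L}).
by rewrite card_finvect -dE -[RHS]/(q ^ dim (subvs_of E))%N dimvf.
Qed.

End FiniteExtension.

(** * The words attached to Hermitian matrices *)

Section HermitianCode.
Variables (F : finFieldType) (L : fieldExtType F) (x : L) (m : nat).
Local Notation q := #|F|.
Local Notation n := (q ^ (2 * m) - 1)%N.
Variables (m1 : (1 < m)%N) (dimL : \dim {:L} = (2 * m)%N).
Variable prim_x : n.-primitive_root x.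
Variables (K : finFieldType) (emb : {rmorphism K -> L}).
Variable cardK : #|K| = (q ^ 2)%N.
Variables (s : {rmorphism K -> K}) (sE : forall z, s z = z ^+ q).

Let q1 : (1 < q)%N. Proof. exact: finNzRing_gt1. Qed.

Let m0 : (0 < m)%N. Proof. exact: ltnW. Qed.

Lemma expr_qj_sum I (r : seq I) (f : I -> L) j :
  (\sum_(i <- r) f i) ^+ (q ^ j) = \sum_(i <- r) f i ^+ (q ^ j).
Proof.
have [|t tE] := @exists_frobenius L (q ^ j); first by rewrite pnatX pnat_pchar_ext.
by rewrite -tE rmorph_sum; apply: eq_bigr => i _; rewrite tE.
Qed.

(** The trace of [L] over its subfield with q^2 elements, as [L] has dimension 2m over [F]. *)
Definition rel_trace (y : L) : L := \sum_(k < m) y ^+ (q ^ (2 * k)).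

(** The power q^2 permutes the summands cyclically: the last becomes y^(q^(2m)) = y. *)
Lemma rel_trace_fixed y : rel_trace y ^+ #|K| = rel_trace y.
Proof.
rewrite cardK /rel_trace expr_qj_sum.
rewrite -(big_mkord xpredT (fun k => (y ^+ (q ^ (2 * k))) ^+ (q ^ 2))).
rewrite -(big_mkord xpredT (fun k => y ^+ (q ^ (2 * k)))).
rewrite -(prednK m0) big_nat_recr //= [RHS]big_nat_recl //= addrC.
congr (_ + _); last first.
  by apply: eq_bigr => k _; rewrite -exprM -expnD mulnS addnC.
rewrite -exprM -expnD -mulnSr prednK // -dimL expr_card_ext.
by rewrite muln0 expn0 expr1.
Qed.

Lemma rel_traceB y z : rel_trace (y - z) = rel_trace y - rel_trace z.
Proof.
rewrite /rel_trace -sumrB; apply: eq_bigr => k _.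
have pk : [pchar L].-nat (q ^ (2 * k))%N by rewrite pnatX pnat_pchar_ext.
by rewrite (exprDn_pchar _ _ pk) (exprNn_pchar _ pk).
Qed.

Fact coords_subproof y (i : 'I_m) :
  exists k, emb k == rel_trace (x ^+ i * y).
Proof.
have [k kE] := mem_image_finField emb (rel_trace_fixed (x ^+ i * y)).
by exists k; rewrite kE.
Qed.

Definition coords (y : L) : 'rV[K]_m := \row_i xchoose (coords_subproof y i).

Lemma coordsE y i : emb (coords y 0 i) = rel_trace (x ^+ i * y).
Proof. by rewrite mxE; apply/eqP/(xchooseP (coords_subproof y i)). Qed.

(* If all Tr(x^i d) vanish, so does sum_k p(x^(q^(2k))) d^(q^(2k)) for every
   polynomial p of degree < m; take p vanishing at all conjugates but x. *)
Lemma coords_inj : injective coords.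
Proof.
move=> y z yz; apply/eqP; rewrite -subr_eq0; set d := y - z.
have d_tr (i : 'I_m) : rel_trace (x ^+ i * d) = 0.
  by rewrite mulrBr rel_traceB -!coordsE yz subrr.
pose X k := x ^+ (q ^ (2 * k)).
pose p := \prod_(k <- index_iota 1 m) ('X - (X k)%:P).
have sp : size p = m by rewrite /p size_prod_XsubC size_iota subn1 prednK.
(* For 0 < k < m the conjugate x^(q^(2k)) differs from x, because the order of x exceeds q^(2k) -
   1. *)
have p0 : ~~ root p (X 0%N).
  rewrite /root horner_prod prodf_seq_neq0; apply/allP => k /=.
  rewrite mem_index_iota => /andP[k0 km].
  rewrite hornerXsubC subr_eq0 /X muln0 expn0 expr1; apply/eqP => xk.
  have k2 : (1 < q ^ (2 * k))%N by rewrite -(expn0 q) ltn_exp2l // muln_gt0.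
  have : x ^+ (q ^ (2 * k) - 1) = 1.
    apply: (mulfI (primitive_root_neq0 prim_x)).
    by rewrite mulr1 -exprS subn1 prednK ?(ltnW k2).
  move/eqP; rewrite -(prim_order_dvd prim_x) => /dvdn_leq.
  rewrite subn_gt0 k2 => /(_ isT); rewrite leq_sub2rE ?(ltnW k2) //.
  by rewrite leq_exp2l // leq_pmul2l // leqNgt km.
have: \sum_(i < m) p`_i * rel_trace (x ^+ i * d) = 0.
  by rewrite big1 // => i _; rewrite d_tr mulr0.
under eq_bigr => i _ do rewrite /rel_trace mulr_sumr.
rewrite exchange_big /=.
rewrite (eq_bigr (fun k : 'I_m => p.[X k] * d ^+ (q ^ (2 * k)))) => [|k _]; last first.
  rewrite (horner_coef_wide _ (eq_leq sp)) mulr_suml; apply: eq_bigr => i _.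
  by rewrite exprMn mulrA -!exprM mulnC.
rewrite (bigD1 (Ordinal m0)) //= big1 => [|k k0].
  move/eqP; rewrite addr0 mulf_eq0 -/(root p _) (negPf p0) /=.
  by rewrite muln0 expn0 expr1.
suff /eqP-> : p.[X k] == 0 by rewrite mul0r.
rewrite /p horner_prod prodf_seq_eq0; apply/hasP; exists (k : nat).
  rewrite mem_index_iota ltn_ord andbT lt0n; apply: contra k0 => /eqP k0.
  exact/eqP/val_inj.
by rewrite hornerXsubC subrr eqxx.
Qed.

Lemma coords0 : coords 0 = 0.
Proof.
apply/rowP => i; apply: (fmorph_inj emb); rewrite coordsE mulr0 mxE rmorph0.
by rewrite /rel_trace big1 // => k _; rewrite expr0n eqn0Ngt expn_gt0 ltnW.
Qed.

(** For Hermitian [A] the form values are fixed by [s] and so come from [F]; the default 0 is then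
    never reached, see [codewordE]. *)
Definition codeword (A : 'M[K]_m) : 'rV[F]_n :=
  \row_j odflt 0 [pick a : F | a%:A == emb (hform s A (coords (x ^+ j)))].

Lemma codewordE A (j : 'I_n) : hermitian s A ->
  (codeword A 0 j)%:A = emb (hform s A (coords (x ^+ j))).
Proof.
move=> hA; rewrite mxE; case: pickP => [a /eqP //|no_a].
have [|a aE] := @mem_image_finField F L (in_alg L) (emb (hform s A (coords (x ^+ j)))).
  by rewrite -rmorphXn -sE (hform_fixed cardK sE).
by have := no_a a; rewrite -aE eqxx.
Qed.

Lemma codewordB A B : hermitian s A -> hermitian s B ->
  codeword (A - B) = codeword A - codeword B.
Proof.
move=> hA hB; apply/rowP => j; apply: (fmorph_inj (in_alg L)).
rewrite /= codewordE ?hermitianB // [(codeword A - _) 0 j]mxE.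
rewrite [(- codeword B) 0 j]mxE scalerBl !codewordE // -rmorphB.
by congr (emb _); rewrite /hform /sesqui mulmxBr mulmxBl !mxE.
Qed.

(** Through [coords (x ^+ j)] the positions j correspond bijectively to the nonzero vectors of K^m,
    so the weight counts vectors of nonzero form value. *)
Lemma hweight_codeword A : hermitian s A ->
  (hweight (codeword A))%:R = weight q m (\rank A).
Proof.
move=> hA; rewrite -(card_hform_neq0 cardK sE hA m0) /hweight; congr _%:R.
pose v (j : 'I_n) := coords (x ^+ j).
have v_inj : injective v.
  move=> i j /coords_inj/eqP; rewrite (eq_prim_root_expr prim_x).
  by rewrite !modn_small // => /eqP/val_inj.
(* There are exactly n nonzero vectors, so injectivity implies surjectivity. *)
have v_full u : u != 0 -> exists j, v j = u.
  have : [set v j | j in 'I_n] = [set~ 0].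
    apply/eqP; rewrite eqEcard; apply/andP; split.
      apply/subsetP => _ /imsetP[j _ ->]; rewrite !inE -coords0.
      apply/eqP => /coords_inj/eqP; rewrite expf_eq0.
      by rewrite (negPf (primitive_root_neq0 prim_x)) andbF.
    rewrite card_imset // card_ord cardsC1 card_mx mul1n cardK -expnM.
    by rewrite subn1.
  move=> im_v u0; have : u \in [set v j | j in 'I_n] by rewrite im_v !inE.
  by case/imsetP => j _ ->; exists j.
rewrite -(card_imset _ v_inj); apply: eq_card => u; rewrite inE.
have cw0 j : (codeword A 0 j != 0) = (hform s A (v j) != 0).
  by rewrite -(fmorph_eq0 (in_alg L)) /= codewordE // fmorph_eq0.
apply/imsetP/idP => [[j]|fu].
  by rewrite inE cw0 => ? ->.
have u0 : u != 0.
  by apply: contra fu => /eqP ->; rewrite /hform /sesqui !mul0mx mxE.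
have [j jE] := v_full u u0; exists j => //.
by rewrite inE cw0 jE.
Qed.

(** The word of [A - B] is zero, while every nonzero rank has positive weight. *)
Lemma codeword_inj A B : hermitian s A -> hermitian s B ->
  codeword A = codeword B -> A = B.
Proof.
move=> hA hB /eqP; rewrite -subr_eq0 -codewordB // => /eqP cAB.
have := hweight_codeword (hermitianB hA hB).
have -> : hweight (codeword (A - B)) = 0%N.
  apply/eqP; rewrite cAB cards_eq0; apply/eqP/setP => j.
  by rewrite !inE mxE eqxx.
have := rank_leq_row (A - B); case: (posnP (\rank (A - B))) => [/eqP|r0 rm].
  by rewrite mxrank_eq0 subr_eq0 => /eqP.
move=> w0; have := lt_le_trans (weight2_gt0 q1 m1) (weight2_le q1 r0 rm).
by rewrite -w0 ltxx.
Qed.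

Lemma rel_trace_expq w :
  rel_trace w ^+ q = \sum_(l < m) w ^+ (q ^ (2 * l + 1)).
Proof.
have := expr_qj_sum (index_enum 'I_m) (fun l => w ^+ (q ^ (2 * l))) 1.
rewrite expn1 /rel_trace => ->; apply: eq_bigr => l _.
by rewrite -exprM expnD expn1.
Qed.

(** The coordinates contribute the exponents q^(2k) and their conjugates the exponents q^(2l+1).
    Only the exponents matter later, so the coefficients stay existential. *)
Lemma emb_hform_coords A : exists B : 'I_m -> 'I_m -> L,
  forall y, emb (hform s A (coords y)) =
    \sum_(k < m) \sum_(l < m) B k l * y ^+ (q ^ (2 * k) + q ^ (2 * l + 1)).
Proof.
exists (fun k l => \sum_(j < m) \sum_(i < m)
  emb (A i j) * (x ^+ i) ^+ (q ^ (2 * k)) * (x ^+ j) ^+ (q ^ (2 * l + 1))).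
move=> y; rewrite /hform /sesqui mxE rmorph_sum.
under [RHS]eq_bigr do under eq_bigr do rewrite mulr_suml.
under [RHS]eq_bigr do rewrite exchange_big /=.
rewrite [RHS]exchange_big /=; apply: eq_bigr => j _.
under [RHS]eq_bigr do under eq_bigr do rewrite mulr_suml.
rewrite rmorphM [(coords y *m A) 0 j]mxE rmorph_sum mulr_suml /=.
under [RHS]eq_bigr do rewrite exchange_big /=.
rewrite [RHS]exchange_big /=; apply: eq_bigr => i _.
rewrite rmorphM coordsE /= [adjoint _ _ j 0]mxE [_^T j 0]mxE sE rmorphXn coordsE.
rewrite rel_trace_expq /rel_trace -mulrA mulr_suml; apply: eq_bigr => k _.
rewrite !mulr_sumr; apply: eq_bigr => l _.
by rewrite !exprMn exprD; ring.
Qed.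

(* c(y) is a combination of geometric sums of ratio x^s y with s ranging over
   the exponents of the form, and each of them vanishes unless y = x^(-s). *)
Lemma dvdp_mul_codeword (h : {poly F}) A : hermitian s A ->
  (forall k l : 'I_m, root (map_poly (in_alg L) h)
     (x ^- (q ^ (2 * k) + q ^ (2 * l + 1)))) ->
  'X^n - 1 %| h * rVpoly (codeword A).
Proof.
move=> hA rh; rewrite -(dvdp_map (in_alg L)) rmorphM rmorphB /= map_polyXn rmorph1.
(* Over [L], X^n - 1 is the product of the distinct X - x^u, so it suffices to test each x^u. *)
rewrite -(factor_Xn_sub_1 prim_x) -(big_map (fun i => x ^+ i) xpredT
  (fun z => 'X - z%:P)).
apply: uniq_roots_dvdp; last first.
  rewrite uniq_rootsE map_inj_in_uniq ?iota_uniq // => i j.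
  rewrite !mem_index_iota /= => i_n j_n /eqP.
  by rewrite (eq_prim_root_expr prim_x) !modn_small // => /eqP.
apply/allP => _ /mapP[u _ ->]; set y := x ^+ u.
rewrite rootM; apply/orP.
have [/existsP[k /existsP[l /eqP xy]]|no_kl] := boolP [exists k : 'I_m,
    exists l : 'I_m, x ^+ (q ^ (2 * k) + q ^ (2 * l + 1)) * y == 1].
  have xs0 : x ^+ (q ^ (2 * k) + q ^ (2 * l + 1)) != 0.
    by rewrite expf_neq0 // (primitive_root_neq0 prim_x).
  left; have := rh k l; congr (root _ _); apply/esym/(mulfI xs0).
  by rewrite xy mulfV.
right; have [B BE] := emb_hform_coords A.
rewrite rootE (@horner_coef_wide _ n); last first.
  by rewrite size_map_poly; exact: size_poly.
under eq_bigr => j _.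
  rewrite coef_map coef_rVpoly_ord /= codewordE // BE mulr_suml.
  under eq_bigr => k _.
    rewrite mulr_suml.
    under eq_bigr => l _ do rewrite -mulrA -exprM mulnC exprM -exprMn.
    over.
  over.
(* With the sum over positions innermost, each (k, l) gives a geometric sum whose ratio is an n-th
   root of unity other than 1. *)
rewrite exchange_big big1 //= => k _; rewrite exchange_big big1 //= => l _.
rewrite -mulr_sumr sum_expr_unity ?mulr0 //.
  rewrite exprMn -exprM mulnC exprM (prim_expr_order prim_x) expr1n mul1r.
  by rewrite /y -exprM mulnC exprM (prim_expr_order prim_x) expr1n.
by move: no_kl; rewrite negb_exists => /forallP/(_ k); rewrite negb_exists => /forallP/(_ l).
Qed.

End HermitianCode.

(** * Degree and roots of the parity-check polynomial *)

Lemma leq_size_prod_monic (R : nzRingType) (I : Type) (r : seq I)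
    (P : I -> {poly R}) d :
  (forall i, P i \is monic) -> (forall i, ((size (P i)).-1 <= d)%N) ->
  ((size (\prod_(i <- r) P i)%R).-1 <= size r * d)%N.
Proof.
move=> mP sP; elim: r => [|i r IH]; first by rewrite big_nil size_poly1.
have mr : \prod_(j <- r) P j \is monic by apply: monic_prod.
rewrite big_cons size_monicM ?monic_neq0 //= mulSn.
have := sP i; have := IH; have := size_poly_gt0 (P i); rewrite monic_neq0 //.
have := size_poly_gt0 (\prod_(j <- r) P j); rewrite (monic_neq0 mr).
move: (size _) (size (P i)) => u v; lia.
Qed.

Section ParityCheckPolynomial.
Variables (F : finFieldType) (L : fieldExtType F) (x : L) (m : nat).
Local Notation q := #|F|.
Variables (even_m : ~~ odd m) (dimL : \dim {:L} = (2 * m)%N).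

Lemma monic_h (u : int) : h_ x u \is monic.
Proof. by rewrite -(map_monic (in_alg L)) map_minPolyF monic_minPoly. Qed.

Lemma monic_h' : h'_ x q m \is monic.
Proof. by apply: monic_prod => i _; apply: monic_h. Qed.

Lemma leq_size_h (u : int) : ((size (h_ x u)).-1 <= 2 * m)%N.
Proof.
rewrite -(size_map_poly (in_alg L)) map_minPolyF size_minPoly /= -dimL.
have := dim_Fadjoin 1%AS (x ^ (- u)); rewrite dimv1 muln1 => <-.
by rewrite dimvS ?subvf.
Qed.

(** As m is even there are m/2 factors, each of degree at most 2m. Equality follows only from
    counting codewords in [h'_dvd]. *)
Lemma leq_size_h' : ((size (h'_ x q m)).-1 <= m ^ 2)%N.
Proof.
have -> : (m ^ 2 = size (index_iota 1 m./2.+1) * (2 * m))%N.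
  by rewrite size_iota subn1 /= mulnA muln2 even_halfK // mulnn.
by apply: leq_size_prod_monic => i; rewrite ?monic_h ?leq_size_h.
Qed.

Lemma root_h' i a : (0 < i <= m./2)%N ->
  root (map_poly (in_alg L) (h'_ x q m)) (x ^- (q ^ (2 * i - 1) + 1) ^+ (q ^ a)).
Proof.
move=> i_m; apply: root_frobenius.
rewrite rmorph_prod rootE horner_prod prodf_seq_eq0; apply/hasP; exists i.
  by rewrite mem_index_iota ltnS.
by rewrite /= map_minPolyF -exprnN -rootE root_minPoly.
Qed.

(* The exponents q^a + q^b and q^b + q^(a + 2m) agree modulo q^(2m) - 1, so
   b - a may be replaced by 2m - (b - a). *)
Lemma root_h'_pair a b : (a < b < 2 * m)%N -> odd (b - a) ->
  root (map_poly (in_alg L) (h'_ x q m)) (x ^- (q ^ a + q ^ b)).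
Proof.
move=> /andP[ab b2m] odd_ba.
have [le_m|gt_m] := leqP (b - a) m.
  (* As m is even and b - a is odd, b - a <= m gives i <= m/2. *)
  pose i := (b - a).+1./2.
  have ba : (b - a = 2 * i - 1)%N by rewrite /i; lia.
  have := @root_h' i a; rewrite -ba exprVn -exprM mulnDl mul1n -expnD addnC subnK ?(ltnW ab) //.
  by apply; rewrite /i; lia.
pose i := (2 * m - (b - a)).+1./2.
have ba : (2 * m - (b - a) = 2 * i - 1)%N by rewrite /i; lia.
have := @root_h' i b; rewrite -ba exprVn -exprM mulnDl mul1n -expnD.
have -> : (2 * m - (b - a) + b = 2 * m + a)%N by lia.
rewrite expnD exprD exprM -dimL expr_card_ext -exprD.
by apply; rewrite /i; lia.
Qed.

End ParityCheckPolynomial.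

(** * Identification of the code, its parameters and its weights *)

Lemma hdistE (F : finFieldType) n (u v : 'rV[F]_n) : hdist u v = hweight (u - v).
Proof. by apply: eq_card => i; rewrite !inE !mxE subr_eq0. Qed.

Section Main.
Variables (m : nat) (F : finFieldType) (L : fieldExtType F) (x : L).
Local Notation q := #|F|.
Local Notation n := (q ^ (2 * m) - 1)%N.
Variables (m1 : (1 < m)%N) (even_m : ~~ odd m) (dimL : \dim {:L} = (2 * m)%N).
Variable prim_x : n.-primitive_root x.
Variables (K : finFieldType) (emb : {rmorphism K -> L}).
Variable cardK : #|K| = (q ^ 2)%N.
Variables (s : {rmorphism K -> K}) (sE : forall z, s z = z ^+ q).

Local Notation h' := (h'_ x q m).
Local Notation Xn := ('X^n - 1 : {poly F}).
Local Notation cw := (codeword x m1 dimL emb cardK s).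
Local Notation herm := [set A : 'M[K]_m | hermitian s A].

Let q1 : (1 < q)%N. Proof. exact: finNzRing_gt1. Qed.
Let m0 : (0 < m)%N. Proof. exact: ltnW. Qed.
Let n0 : (0 < n)%N. Proof. exact: prim_order_gt0 prim_x. Qed.

(** The numbers 2k and 2l + 1 are below 2m and differ by an odd number, so [root_h'_pair] applies
    after ordering them. *)
Lemma root_gcd_h' (k l : 'I_m) :
  root (map_poly (in_alg L) (gcdp h' Xn)) (x ^- (q ^ (2 * k) + q ^ (2 * l + 1))).
Proof.
have k_m := ltn_ord k; have l_m := ltn_ord l.
rewrite gcdp_map root_gcd; apply/andP; split; last first.
  rewrite rmorphB /= map_polyXn rmorph1 rootE !hornerE.
  by rewrite exprVn -exprM mulnC exprM (prim_expr_order prim_x) expr1n invr1 subrr.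
have [kl|lk] := ltnP (2 * k)%N (2 * l + 1)%N.
  by apply: root_h'_pair => //; lia.
by rewrite addnC; apply: root_h'_pair => //; lia.
Qed.

Lemma card_codewords : #|cw @: herm| = (q ^ (m ^ 2))%N.
Proof.
rewrite card_in_imset ?(card_hermitian cardK sE) // => A B; rewrite !inE.
by apply: codeword_inj.
Qed.

Lemma codeword_in_code (h : {poly F}) A : h %| Xn -> hermitian s A ->
  Xn %| h * rVpoly (cw A) -> cw A \in cyclic_code n (Xn %/ h).
Proof.
move=> hX hA; rewrite mem_cyclic_code ?divp_dvd //.
rewrite -{1}(divpK hX) mulrC dvdp_mul2l //.
exact: dvdpN0 hX (monic_neq0 (monic_Xn_sub1 F n0)).
Qed.

Lemma dim_code (h : {poly F}) : h %| Xn -> (n - (size (Xn %/ h)%R).-1)%N = (size h).-1.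
Proof.
move=> hX.
have Xn0 := monic_neq0 (monic_Xn_sub1 F n0).
have h0 : h != 0 := dvdpN0 hX Xn0.
have g0 : Xn %/ h != 0 by rewrite dvdp_div_eq0.
have := size_Xn_sub1 F n0; rewrite -{1}(divpK hX) size_mul //.
have := size_poly_gt0 h; have := size_poly_gt0 (Xn %/ h); rewrite h0 g0.
by move: (size h) (size _) => u v; lia.
Qed.

(* The codewords of Hermitian matrices lie in the code with parity-check
   polynomial gcd(h', X^n - 1); counting them forces the gcd to be h'. *)
Lemma h'_dvd : h' %| Xn /\ (size h').-1 = (m ^ 2)%N.
Proof.
set h1 := gcdp h' Xn.
have h1X : h1 %| Xn := dvdp_gcdr _ _.
have h1h : h1 %| h' := dvdp_gcdl _ _.
have [V [CV dV]] := cyclic_code_vspace n0 (divp_dvd h1X).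
have sub : cw @: herm \subset cyclic_code n (Xn %/ h1).
  apply/subsetP => c /imsetP[A]; rewrite inE => hA ->.
  apply: (codeword_in_code h1X hA).
  exact (dvdp_mul_codeword m1 dimL prim_x emb cardK sE hA root_gcd_h').
have := subset_leq_card sub; rewrite card_codewords.
(* The q^(m^2) words lie in a space of dimension deg h1, whence m^2 <= deg h1 <= deg h' <= m^2. *)
rewrite (eq_card CV) card_vspace dV dim_code // leq_exp2l // => le1.
have le2 := leq_size_h' x even_m dimL.
have le3 := dvdp_leq (monic_neq0 (monic_h' x m)) h1h.
have h10 := dvdpN0 h1X (monic_neq0 (monic_Xn_sub1 F n0)).
have s1 := size_poly_gt0 h1; rewrite h10 in s1.
have eqs : size h1 = size h'.
  by move: le1 le2 le3 s1; move: (size h1) (size h') (m ^ 2)%N => a b c; lia.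
split; last by apply/eqP; rewrite eqn_leq le2 -eqs le1.
have : h1 %= h' by rewrite -dvdp_size_eqp // eqs.
by move=> /eqp_dvdl <-.
Qed.

Let h'X : h' %| Xn. Proof. by case: h'_dvd. Qed.

Lemma code_codewords : C_ x q m = cw @: herm.
Proof.
have [V [CV dV]] := cyclic_code_vspace n0 (divp_dvd h'X).
apply/esym/eqP; rewrite eqEcard; apply/andP; split.
  apply/subsetP => c /imsetP[A]; rewrite inE => hA ->.
  apply: (codeword_in_code h'X hA).
  apply: (dvdp_trans (dvdp_mul_codeword m1 dimL prim_x emb cardK sE hA root_gcd_h')).
  exact: dvdp_mul (dvdp_gcdl _ _) (dvdpp _).
rewrite card_codewords (eq_card CV) card_vspace dV dim_code //.
by case: h'_dvd => _ ->.
Qed.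

Lemma parity_check : cyclic_with_parity_check (C_ x q m) h'.
Proof.
exists (Xn %/ h'); split=> //.
- by rewrite -(monicMr _ (monic_h' x m)) divpK // monic_Xn_sub1.
- exact: divp_dvd.
- have g0 : Xn %/ h' != 0.
    by rewrite dvdp_div_eq0 // (monic_neq0 (monic_Xn_sub1 F n0)).
  by rewrite -[LHS](mulKp _ g0) divpK.
Qed.

Lemma weight_distribution : has_weight_distribution (C_ x q m)
  ((0, 1) :: [seq (weight q m j, freq q m j) | j <- iota 1 m]).
Proof.
move=> w; rewrite /weight_count code_codewords.
pose phi r : rat := if weight q m r == w%:R then 1 else 0.
transitivity (\sum_(A : 'M[K]_m | hermitian s A) phi (\rank A)).
  have -> : [set c in cw @: herm | hweight c == w]
      = cw @: [set A in herm | hweight (cw A) == w].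
    apply/setP => c; rewrite inE; apply/andP/imsetP => [[/imsetP[A hA ->] wc]|[A]].
      by exists A; rewrite // inE hA.
    by rewrite inE => /andP[hA wA] ->; rewrite imset_f.
  rewrite card_in_imset => [|A B]; last first.
    by rewrite !inE => /andP[hA _] /andP[hB _]; apply: codeword_inj.
  rewrite -sum1_card natr_sum /phi -big_mkcondr /=; apply: eq_bigl => A.
  rewrite !inE; case: (boolP (hermitian s A)) => //= hA.
  by rewrite -(hweight_codeword m1 dimL prim_x emb cardK sE hA) eqr_nat.
(* Rank 0 is split off: it produces the entry (0, 1) of the list. *)
rewrite (sum_hermitian_rank cardK sE) big_nat_recl // freq0 mul1r.
rewrite big_cons big_map (iotaDl 1 0 m) big_map /index_iota subn0 /phi weight0 //=.
rewrite [in RHS]big_mkcond /=.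
rewrite [X in _ + X = _](eq_bigr (fun r =>
    if weight q m r.+1 == w%:R then freq q m r.+1 else 0)).
  by rewrite eq_sym; case: ifP => _ //; rewrite add0r.
by move=> r _; case: ifP => _; rewrite ?mulr1 ?mulr0.
Qed.

(** By linearity the minimum distance is the least weight over the ranks 1 to m, attained at rank
    2. *)
Lemma code_parameters : exists2 d : nat,
  d%:R = (q%:R ^+ (2 * m) - q%:R ^+ (2 * m - 1)) * (1 - q%:R ^- 2) :> rat
  & is_code (C_ x q m) (m ^ 2) d.
Proof.
(* A Hermitian witness of rank exactly 2, since m >= 2. *)
pose A2 : 'M[K]_m := pid_mx 2.
have hA2 : hermitian s A2 by rewrite /hermitian /adjoint tr_pid_mx map_pid_mx.
have wA2 : (hweight (cw A2))%:R = weight q m 2.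
  by rewrite (hweight_codeword m1 dimL prim_x emb cardK sE hA2) rank_pid_mx.
exists (hweight (cw A2)); first by rewrite wA2 weight2E.
have [V [CV dV]] := cyclic_code_vspace n0 (divp_dvd h'X).
have VC c : (c \in V) = (c \in cw @: herm) by rewrite -code_codewords CV.
have cw0 : cw 0 = 0.
  have h0 : hermitian s (0 : 'M[K]_m) by rewrite /hermitian adjoint_eq0.
  by rewrite -[X in cw X](subrr 0) codewordB // subrr.
exists V; split=> //.
  by rewrite dV dim_code //; case: h'_dvd.
split=> [|u v uV vV uv].
  exists (cw A2), 0; split; rewrite ?mem0v ?hdistE ?subr0 //.
    by rewrite VC imset_f // inE.
  apply/eqP => c0; move: wA2; rewrite c0.
  have -> : hweight (0 : 'rV[F]_n) = 0%N.
    by apply/eqP; rewrite cards_eq0; apply/eqP/setP => j; rewrite !inE mxE eqxx.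
  by move=> w2; have := weight2_gt0 q1 m1; rewrite -w2 ltxx.
rewrite hdistE; have : u - v \in V by rewrite rpredB.
rewrite VC => /imsetP[A]; rewrite inE => hA uvA.
have r0 : (0 < \rank A)%N.
  rewrite lt0n mxrank_eq0; apply: contra uv => /eqP A0.
  by rewrite -subr_eq0 uvA A0 cw0.
rewrite uvA -(ler_nat rat) wA2 (hweight_codeword m1 dimL prim_x emb cardK sE hA).
exact: weight2_le (rank_leq_row A).
Qed.

End Main.

Theorem mainTheorem2 (q m : nat) (F : finFieldType) (L : fieldExtType F)
    (x : L) (hq : #|F| = q) (hm0 : (0 < m)%N) (hm : ~~ odd m)
    (hL : \dim {:L} = (2 * m)%N) (hx : is_mul_generator x) :
  [/\ cyclic_with_parity_check (C_ x q m) (h'_ x q m),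
      exists2 d : nat,
        d%:R = (q%:R ^+ (2 * m) - q%:R ^+ (2 * m - 1)) * (1 - q%:R ^- 2) :> rat
        & is_code (C_ x q m) (m ^ 2) d
    & has_weight_distribution (C_ x q m)
        ((0, 1) :: [seq (weight q m j, freq q m j) | j <- iota 1 m])].
Proof.
(* A positive even m is at least 2, so rank 2 occurs. *)
have m1 : (1 < m)%N by case: m hm0 hm {hL} => [|[]].
have prim_x := mul_generator_primitive hx; rewrite hL in prim_x; subst q.
have [K [emb cardK]] := exists_quadratic_subfield hm0 prim_x.
have [s sE] := exists_frobenius (pnat_pchar_q cardK).
split; [exact: parity_check cardK s sE | exact: code_parameters cardK s sE |].
exact: weight_distribution cardK s sE.
Qed.
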